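(* Let $T$ and $T'$ be complete classical first-order theories in countable languages (satisfying the standing assumptions below), and assume that $T$ and $T'$ are bi-interpretable. Let $\Phi$ be a rich sequence for the language of $T$ and $\Psi$ a rich sequence for the language of $T'$. Then $\mathbf{G}_\Phi(T)$ and $\mathbf{G}_\Psi(T')$ are isomorphic as topological groupoids. In other words, up to isomorphism of topological groupoids, $\mathbf{G}_\Phi(T)$ does not depend on $\Phi$, and depends on $T$ only up to bi-interpretation.
   Context: Standing assumptions: theories are complete classical (two-valued) first-order theories in a countable language; structures are nonempty and no model of the theory is a singleton. For simplicity the language is single-sorted (the multi-sorted case is analogous, with each variable assigned a sort). ''Definable'' means without parameters. A groupoid is a set $\mathbf{G}$ with a partial associative composition and an inversion $g\mapsto g^{-1}$ such that $g^{-1}g$ and $gg^{-1}$ are always defined and $fgg^{-1}=f$, $f^{-1}fg=g$ whenever $fg$ is defined; $s_g=g^{-1}g$ (source), $t_g=gg^{-1}$ (target), and the base $\mathbf{B}$ is the set of $e$ with $e^2=e$. A topological groupoid is a groupoid with a Hausdorff topology making composition (where defined) and inversion continuous. A sequence $\Phi=(\varphi_n(x_{<n},y):n\in\mathbb{N})$ of formulas, $y$ a single variable, is rich if every formula $\varphi(x_{<k},y)$ appears (with dummy variables) as $\varphi_n$ for some $n\ge k$. Put $D_{\Phi,n}(x_{<n})=\bigwedge_{k<n}\forall y\,[\varphi_k(x_{<k},y)\to\varphi_k(x_{\le k})]$ and $D_\Phi(x)=\bigwedge_n D_{\Phi,n}(x_{<n})$, a partial type in an infinite tuple $x=(x_n)_{n\in\mathbb{N}}$.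 Let $\mathbf{G}_\Phi(T)$ be the set of complete types $\mathrm{tp}(a,b)$ (in the space $S_{2\times\mathbb{N}}(T)$ of types of pairs of $\mathbb{N}$-indexed sequences, with the usual logic topology, and $\mathbf{G}_\Phi(T)$ with the subspace topology) such that $a,b$ both realise $D_\Phi$ and have the same set of entries (this set is then a countable model). Composition is $\mathrm{tp}(a,b)\cdot\mathrm{tp}(b,c)=\mathrm{tp}(a,c)$ (defined when the type of the middle tuple agrees) and inversion $\mathrm{tp}(a,b)^{-1}=\mathrm{tp}(b,a)$; the base consists of the types $\mathrm{tp}(a,a)$. *)

(* Defs.v *)
From Stdlib Require Import Arith.
From Stdlib Require Vectors.Fin.

Set Implicit Arguments.

Record language := {
  Func : Type;
  Rel : Type;
  farity : Func -> nat;
  rarity : Rel -> nat;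
  Func_countable : exists enc : Func -> nat, forall f g, enc f = enc g -> f = g;
  Rel_countable : exists enc : Rel -> nat, forall r s, enc r = enc s -> r = s
}.

Section Syntax.
Variable L : language.

Inductive term : Type :=
| tvar : nat -> term
| tapp : forall f : Func L, (Fin.t (farity L f) -> term) -> term.

Inductive formula : Type :=
| fEq : term -> term -> formula
| fRel : forall r : Rel L, (Fin.t (rarity L r) -> term) -> formula
| fNot : formula -> formula
| fAnd : formula -> formula -> formula
| fEx : nat -> formula -> formula.

Fixpoint tfree (v : nat) (t : term) : Prop :=
  match t with
  | tvar w => v = w
  | tapp f ts => exists i, tfree v (ts i)
  end.

Fixpoint ffree (v : nat) (phi : formula) : Prop :=
  match phi with
  | fEq t1 t2 => tfree v t1 \/ tfree v t2
  | fRel r ts => exists i, tfree v (ts i)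
  | fNot psi => ffree v psi
  | fAnd psi chi => ffree v psi \/ ffree v chi
  | fEx w psi => v <> w /\ ffree v psi
  end.

Definition fv_below (n : nat) (phi : formula) : Prop :=
  forall v, ffree v phi -> v < n.

Definition sentence (phi : formula) : Prop := forall v, ~ ffree v phi.

Record structure := {
  carrier :> Type;
  inhab : carrier;
  funs : forall f : Func L, (Fin.t (farity L f) -> carrier) -> carrier;
  rels : forall r : Rel L, (Fin.t (rarity L r) -> carrier) -> Prop
}.

Definition upd {M : Type} (rho : nat -> M) (v : nat) (m : M) : nat -> M :=
  fun w => if Nat.eqb w v then m else rho w.

Fixpoint teval (M : structure) (rho : nat -> M) (t : term) : M :=
  match t with
  | tvar v => rho v
  | tapp f ts => funs M f (fun i => teval M rho (ts i))
  end.

Fixpoint sat (M : structure) (rho : nat -> M) (phi : formula) : Prop :=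
  match phi with
  | fEq t1 t2 => teval M rho t1 = teval M rho t2
  | fRel r ts => rels M r (fun i => teval M rho (ts i))
  | fNot psi => ~ sat M rho psi
  | fAnd psi chi => sat M rho psi /\ sat M rho chi
  | fEx v psi => exists m : M, sat M (upd rho v m) psi
  end.

Definition theory := formula -> Prop.

Definition models (T : theory) (M : structure) : Prop :=
  forall phi, T phi -> forall rho, sat M rho phi.

Definition entails (T : theory) (phi : formula) : Prop :=
  forall M : structure, models T M -> forall rho, sat M rho phi.

Definition complete_theory (T : theory) : Prop :=
  (forall phi, T phi -> sentence phi) /\
  (exists M : structure, models T M) /\
  (forall phi, sentence phi -> entails T phi \/ entails T (fNot phi)).

Definition no_singleton_models (T : theory) : Prop :=
  forall M : structure, models T M -> exists a b : M, a <> b.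

(* Convention: in phi_n(x_{<n}, y), the variable y is variable 0 and
   x_k is variable k+1.  So phi_n has free variables among 0..n. *)
Definition consenv {M : Type} (m : M) (a : nat -> M) : nat -> M :=
  fun v => match v with 0 => m | S i => a i end.

Definition rich (Phi : nat -> formula) : Prop :=
  (forall n, fv_below (S n) (Phi n)) /\
  (forall k phi, fv_below (S k) phi -> exists n, k <= n /\ Phi n = phi).

Definition realises_D (Phi : nat -> formula) (M : structure) (a : nat -> M) : Prop :=
  forall k (m : M), sat M (consenv m a) (Phi k) -> sat M (consenv (a k) a) (Phi k).

Definition same_entries {M : Type} (a b : nat -> M) : Prop :=
  (forall i, exists j, a i = b j) /\ (forall j, exists i, b j = a i).

Definition pairenv {M : Type} (a b : nat -> M) : nat -> M :=
  fun v => if Nat.even v then a (Nat.div2 v) else b (Nat.div2 v).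

Definition tp (M : structure) (a b : nat -> M) : formula -> Prop :=
  fun phi => sat M (pairenv a b) phi.

Definition GPhi_pred (T : theory) (Phi : nat -> formula) (p : formula -> Prop) : Prop :=
  exists M : structure, models T M /\
    exists a b : nat -> M, realises_D Phi M a /\ realises_D Phi M b /\
      same_entries a b /\ p = tp M a b.

Definition GPhi_carrier (T : theory) (Phi : nat -> formula) : Type :=
  { p : formula -> Prop | GPhi_pred T Phi p }.

(* composition as a (partial) operation, given by its graph:
   tp(a,b) . tp(b,c) = tp(a,c) *)
Definition GPhi_comp (T : theory) (Phi : nat -> formula)
  (g h k : GPhi_carrier T Phi) : Prop :=
  exists M : structure, models T M /\
    exists a b c : nat -> M,
      proj1_sig g = tp M a b /\ proj1_sig h = tp M b c /\ proj1_sig k = tp M a c.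

Definition GPhi_inv (T : theory) (Phi : nat -> formula)
  (g k : GPhi_carrier T Phi) : Prop :=
  exists M : structure, models T M /\
    exists a b : nat -> M, proj1_sig g = tp M a b /\ proj1_sig k = tp M b a.

(* subspace topology of the logic topology (basic opens [phi] = {p | phi in p}) *)
Definition GPhi_open (T : theory) (Phi : nat -> formula)
  (U : GPhi_carrier T Phi -> Prop) : Prop :=
  forall g, U g -> exists phi, proj1_sig g phi /\
    forall h : GPhi_carrier T Phi, proj1_sig h phi -> U h.

End Syntax.

Arguments tvar {L} _.

Record tgroupoid := {
  tg_carrier :> Type;
  tg_comp : tg_carrier -> tg_carrier -> tg_carrier -> Prop;
  tg_inv : tg_carrier -> tg_carrier -> Prop;
  tg_open : (tg_carrier -> Prop) -> Prop
}.

Definition G_Phi (L : language) (T : theory L) (Phi : nat -> formula L) : tgroupoid :=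
  {| tg_carrier := GPhi_carrier T Phi;
     tg_comp := @GPhi_comp L T Phi;
     tg_inv := @GPhi_inv L T Phi;
     tg_open := @GPhi_open L T Phi |}.

Definition tgroupoid_iso (A B : tgroupoid) : Prop :=
  exists (F : A -> B) (H : B -> A),
    (forall x, H (F x) = x) /\ (forall y, F (H y) = y) /\
    (forall g h k, tg_comp A g h k <-> tg_comp B (F g) (F h) (F k)) /\
    (forall g k, tg_inv A g k <-> tg_inv B (F g) (F k)) /\
    (forall V, tg_open B V -> tg_open A (fun x => V (F x))) /\
    (forall U, tg_open A U -> tg_open B (fun y => U (H y))).

(* An (n-dimensional, parameter-free) interpretation of L' in L:
   a domain formula D(x_{<n}), an equivalence formula E(x_{<n}, x'_{<n}),
   and for every relation / function symbol of L' a formula defining it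
   (functions via their graphs). *)
Record interp (L L' : language) := {
  idim : nat;
  idom : formula L;
  ieq : formula L;
  irel : forall r : Rel L', formula L;
  ifun : forall f : Func L', formula L
}.

Arguments idim {L L'} _.
Arguments idom {L L'} _.
Arguments ieq {L L'} _.
Arguments irel {L L'} _ _.
Arguments ifun {L L'} _ _.

Definition interp_wf (L L' : language) (G : interp L L') : Prop :=
  fv_below (idim G) (idom G) /\
  fv_below (2 * idim G) (ieq G) /\
  (forall r, fv_below (rarity L' r * idim G) (irel G r)) /\
  (forall f, fv_below (S (farity L' f) * idim G) (ifun G f)).

Definition blockenv {M : Type} (n : nat) (xs : nat -> nat -> M) : nat -> M :=
  fun v => xs (Nat.div v n) (Nat.modulo v n).

Definition pair2 {M : Type} (x y : nat -> M) : nat -> nat -> M :=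
  fun j => match j with 0 => x | _ => y end.

Definition finidx {n : nat} (i : Fin.t n) : nat := proj1_sig (Fin.to_nat i).

Definition interprets (L L' : language) (G : interp L L')
  (M : structure L) (N : structure L') (pi : (nat -> M) -> N) : Prop :=
  let D := fun x : nat -> M => sat M x (idom G) in
  (forall y : N, exists x, D x /\ pi x = y) /\
  (forall x x', D x -> D x' ->
     (pi x = pi x' <-> sat M (blockenv (idim G) (pair2 x x')) (ieq G))) /\
  (forall r (xs : nat -> nat -> M), (forall j, D (xs j)) ->
     (rels N r (fun i => pi (xs (finidx i))) <->
      sat M (blockenv (idim G) xs) (irel G r))) /\
  (forall f (xs : nat -> nat -> M), (forall j, D (xs j)) ->
     (funs N f (fun i => pi (xs (finidx i))) = pi (xs (farity L' f)) <->
      sat M (blockenv (idim G) xs) (ifun G f))).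

Definition interpretation_of (L L' : language) (T : theory L) (T' : theory L')
  (G : interp L L') : Prop :=
  interp_wf G /\
  forall M : structure L, models T M ->
    exists (N : structure L') (pi : (nat -> M) -> N),
      models T' N /\ interprets G M N pi.

Definition struct_iso (L : language) (M M' : structure L) (h : M -> M') : Prop :=
  (exists k : M' -> M, (forall x, k (h x) = x) /\ (forall y, h (k y) = y)) /\
  (forall f args, h (funs M f args) = funs M' f (fun i => h (args i))) /\
  (forall r args, rels M r args <-> rels M' r (fun i => h (args i))).

(* The canonical identification M ~ Delta(Gamma(M)) is an isomorphism
   definable in M (uniformly over models of T) by the L-formula chi(y, z):
   y is variable 0 and z_{j,i} (j < dim Delta, i < dim Gamma) is variable
   1 + j * dim Gamma + i. *)
Definition definable_composite (L L' : language) (T : theory L)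
  (G : interp L L') (Dl : interp L' L) (chi : formula L) : Prop :=
  fv_below (S (idim Dl * idim G)) chi /\
  forall (M : structure L), models T M ->
  forall (N : structure L') (pi : (nat -> M) -> N), interprets G M N pi ->
  forall (M' : structure L) (pi' : (nat -> N) -> M'), interprets Dl N M' pi' ->
  exists h : M -> M', @struct_iso L M M' h /\
    forall (m : M) (zs : nat -> nat -> M),
      sat M (consenv m (blockenv (idim G) zs)) chi <->
      ((forall j, j < idim Dl -> sat M (zs j) (idom G)) /\
       sat N (fun j => pi (zs j)) (idom Dl) /\
       h m = pi' (fun j => pi (zs j))).

Definition bi_interpretable (L L' : language) (T : theory L) (T' : theory L') : Prop :=
  exists (G : interp L L') (Dl : interp L' L) (chi : formula L) (chi' : formula L'),
    interpretation_of T T' G /\ interpretation_of T' T Dl /\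
    definable_composite T G Dl chi /\ definable_composite T' Dl G chi'.

(* Main.v *)
(** The sets [D_Phi] and [D_Psi] are limits of towers of definable sets whose steps add
    one coordinate from a nonempty definable set. Let [M] and [N] interpret each other
    through coordinate maps [pi] and [rho]. If a finite stage of [D_Psi] maps onto a
    finite stage of [D_Phi] through [rho], then by richness some coordinates of a later
    stage of [D_Phi] form a Skolem function for the fibres, so that this stage maps,
    through [pi], onto the given stage of [D_Psi], and the composite is the projection.
    Iterating back and forth gives index maps [U] and [V], independent of the model,
    such that [b_j = pi (a_(U j))] and [a_i = rho (b_(V i))] are inverse bijections
    between [D_Phi] and [D_Psi]. Since they only select coordinates, formulas about [b]
    translate into formulas about [a] and conversely, and [tp(a,a') |-> tp(b,b')] is the
    required isomorphism. *)

From Stdlib Require Import Arith Lia List Bool.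
From Stdlib Require Import ClassicalEpsilon FunctionalExtensionality PropExtensionality.
Require Import Defs.
Import ListNotations.

Set Implicit Arguments.

(** A bi-interpretation gives the composite of the two interpretations only up to an isomorphism,
    whereas the back and forth needs [rho o pi] and [pi o rho] themselves to be definable. Composing
    [rho] with an isomorphism makes [chi] the graph of [rho o pi], but this uses up the freedom: on
    the other side [chi'] then describes [pi o rho] only up to a bijection [h] of [N], given for
    each model separately. The way out is that [h] is itself uniformly definable. Definability is
    treated semantically, for families of structures over a type [K]: one formula has to work for
    every index. With [K] the type of all normalised pairs [(M, N)], in which every model of either
    theory occurs, anything built from definability over [K] is automatically independent of the
    model. *)

(** * Choice, finite bounds and arithmetic of blocks *)

Lemma choice_fun (A B : Type) (R : A -> B -> Prop) :
  (forall a, exists b, R a b) -> exists f : A -> B, forall a, R a (f a).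
Proof.
  intros H.
  exists (fun a => proj1_sig (constructive_indefinite_description _ (H a))).
  intros a. exact (proj2_sig (constructive_indefinite_description _ (H a))).
Qed.

Lemma fin_bound n (Q : Fin.t n -> nat -> Prop) :
  (forall i, exists b, forall v, Q i v -> v < b) ->
  exists b, forall i v, Q i v -> v < b.
Proof.
  induction n as [|n IH]; intros H.
  - exists 0. intros i. inversion i.
  - destruct (H Fin.F1) as [b1 H1].
    destruct (IH (fun i => Q (Fin.FS i))) as [b2 H2]; [intros i; apply H|].
    exists (b1 + b2). intros i. pattern i. apply Fin.caseS'.
    + intros v Hv. specialize (H1 v Hv). lia.
    + intros j v Hv. specialize (H2 j v Hv). lia.
Qed.

Lemma finidx_lt n (i : Fin.t n) : finidx i < n.
Proof. exact (proj2_sig (Fin.to_nat i)). Qed.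

Lemma blockenv_lt d r v : v < r * d -> v / d < r /\ v mod d < d.
Proof.
  intros H. assert (d <> 0) by (intros ->; lia).
  split; [apply Nat.Div0.div_lt_upper_bound; lia | apply Nat.mod_upper_bound; lia].
Qed.

Lemma pairenv_even (M : Type) (a b : nat -> M) i : pairenv a b (2 * i) = a i.
Proof.
  unfold pairenv. rewrite Nat.even_even, Nat.div2_double. reflexivity.
Qed.

Lemma pairenv_odd (M : Type) (a b : nat -> M) i : pairenv a b (2 * i + 1) = b i.
Proof.
  unfold pairenv. rewrite Nat.even_odd, Nat.add_1_r, Nat.div2_succ_double. reflexivity.
Qed.

(** * Free variables and renaming *)

Section Syntax.
Variable L : language.

Lemma tfree_bound (t : term L) : exists n, forall v, tfree v t -> v < n.
Proof.
  induction t as [w|f ts IH]; simpl.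
  - exists (S w). intros v ->. lia.
  - destruct (fin_bound _ IH) as [b Hb]. exists b. intros v [i Hi]. eauto.
Qed.

Lemma fv_bound (phi : formula L) : exists n, fv_below n phi.
Proof.
  unfold fv_below.
  induction phi as [t1 t2|r ts|phi IH|phi1 IH1 phi2 IH2|w phi IH]; simpl.
  - destruct (tfree_bound t1) as [b1 H1], (tfree_bound t2) as [b2 H2].
    exists (b1 + b2). intros v [H|H]; [apply H1 in H|apply H2 in H]; lia.
  - destruct (fin_bound (fun i v => tfree v (ts i))) as [b Hb].
    + intros i. apply tfree_bound.
    + exists b. intros v [i Hi]. eauto.
  - exact IH.
  - destruct IH1 as [b1 H1], IH2 as [b2 H2].
    exists (b1 + b2). intros v [H|H]; [apply H1 in H|apply H2 in H]; lia.
  - destruct IH as [b Hb]. exists b. intros v [_ H]. auto.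
Qed.

Lemma teval_ext (M : structure L) (t : term L) (x y : nat -> M) :
  (forall v, tfree v t -> x v = y v) -> teval M x t = teval M y t.
Proof.
  induction t as [w|f ts IH]; simpl; intros H; auto.
  f_equal. apply functional_extensionality. intros i. apply IH. eauto.
Qed.

Lemma sat_ext (M : structure L) (phi : formula L) : forall x y : nat -> M,
  (forall v, ffree v phi -> x v = y v) -> sat M x phi <-> sat M y phi.
Proof.
  induction phi as [t1 t2|r ts|phi IH|phi1 IH1 phi2 IH2|w phi IH]; simpl; intros x y H.
  - rewrite (teval_ext M t1 x y), (teval_ext M t2 x y) by auto. tauto.
  - replace (fun i => teval M x (ts i)) with (fun i => teval M y (ts i)); [tauto|].
    apply functional_extensionality. intros i. symmetry. apply teval_ext. eauto.
  - rewrite (IH x y H). tauto.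
  - rewrite (IH1 x y), (IH2 x y) by auto. tauto.
  - assert (E : forall m, sat M (upd x w m) phi <-> sat M (upd y w m) phi).
    { intros m. apply IH. intros v Hv. unfold upd.
      destruct (Nat.eqb_spec v w); auto. }
    split; intros [m Hm]; exists m; apply E; exact Hm.
Qed.

Lemma sat_below (M : structure L) n (phi : formula L) (x y : nat -> M) :
  fv_below n phi -> (forall v, v < n -> x v = y v) -> sat M x phi -> sat M y phi.
Proof. intros H E. apply sat_ext. intros v Hv. symmetry. auto. Qed.

Fixpoint tren (s : nat -> nat) (t : term L) : term L :=
  match t with
  | tvar v => tvar (s v)
  | tapp f ts => tapp f (fun i => tren s (ts i))
  end.

Lemma teval_tren (M : structure L) s (x : nat -> M) t :
  teval M x (tren s t) = teval M (fun v => x (s v)) t.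
Proof.
  induction t as [w|f ts IH]; simpl; auto.
  f_equal. apply functional_extensionality. auto.
Qed.

Lemma max_image (s : nat -> nat) n : exists m, forall w, w < n -> s w < m.
Proof.
  induction n as [|n [m Hm]]; [exists 0; lia|].
  exists (S (m + s n)). intros w Hw.
  destruct (Nat.eq_dec w n) as [->|]; [lia|]. specialize (Hm w). lia.
Qed.

Lemma rename (phi : formula L) : forall s : nat -> nat, exists phi',
  forall (M : structure L) (x : nat -> M),
    sat M x phi' <-> sat M (fun v => x (s v)) phi.
Proof.
  induction phi as [t1 t2|r ts|phi IH|phi1 IH1 phi2 IH2|w phi IH]; intros s.
  - exists (fEq (tren s t1) (tren s t2)). intros M x. simpl.
    rewrite !teval_tren. tauto.
  - exists (fRel r (fun i => tren s (ts i))). intros M x. simpl.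
    replace (fun i => teval M x (tren s (ts i)))
      with (fun i => teval M (fun v => x (s v)) (ts i)); [tauto|].
    apply functional_extensionality. intros i. symmetry. apply teval_tren.
  - destruct (IH s) as [p Hp]. exists (fNot p). intros M x. simpl. rewrite Hp. tauto.
  - destruct (IH1 s) as [p Hp], (IH2 s) as [q Hq]. exists (fAnd p q).
    intros M x. simpl. rewrite Hp, Hq. tauto.
  (* The bound variable becomes [w'], above the images under [s] of all free variables, so nothing
     is captured; [s] need not be injective. *)
  - destruct (fv_bound phi) as [n Hn]. destruct (max_image s n) as [w' Hw'].
    destruct (IH (upd s w w')) as [p Hp]. exists (fEx w' p). intros M x. simpl.
    assert (E : forall m, sat M (upd x w' m) p <-> sat M (upd (fun v => x (s v)) w m) phi).
    { intros m. rewrite Hp. apply sat_ext. intros v Hv. unfold upd.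
      destruct (Nat.eqb_spec v w).
      - rewrite Nat.eqb_refl. reflexivity.
      - specialize (Hw' v (Hn v Hv)). destruct (Nat.eqb_spec (s v) w'); [lia|reflexivity]. }
    split; intros [m Hm]; exists m; apply E; exact Hm.
Qed.

Fixpoint exs (l : list nat) (phi : formula L) : formula L :=
  match l with [] => phi | v :: l => fEx v (exs l phi) end.

Lemma sat_exs (M : structure L) phi l : forall x : nat -> M,
  sat M x (exs l phi) <->
  exists x', (forall v, ~ In v l -> x' v = x v) /\ sat M x' phi.
Proof.
  induction l as [|w l IH]; intros x; simpl.
  - split; [intros H; exists x; auto|].
    intros (x' & E & H). replace x with x'; [exact H|].
    apply functional_extensionality. auto.
  - split.
    + intros [m Hm]. apply IH in Hm. destruct Hm as (x' & E & H).
      exists x'. split; auto. intros v Hv. rewrite E by tauto. unfold upd.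
      destruct (Nat.eqb_spec v w); [subst; tauto|reflexivity].
    + intros (x' & E & H). exists (x' w). apply IH. exists x'. split; auto.
      intros v Hv. unfold upd. destruct (Nat.eqb_spec v w); [subst; auto|].
      apply E. intros [->|?]; tauto.
Qed.

End Syntax.

(** * Uniformly definable predicates *)

Section Definable.
Context {L : language} {K : Type}.
Variable M : K -> structure L.

(* Predicates on [I]-indexed tuples, with an arbitrary index type: [s] says
   which coordinate is substituted for each variable of [phi]. *)
Definition definable {I : Type} (P : forall k, (I -> M k) -> Prop) : Prop :=
  exists (phi : formula L) (s : nat -> I),
    forall k x, P k x <-> sat (M k) (fun v => x (s v)) phi.

Lemma definable_ext (I : Type) {P Q : forall k, (I -> M k) -> Prop} :
  definable P -> (forall k x, Q k x <-> P k x) -> definable Q.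
Proof.
  intros (phi & s & H) E. exists phi, s. intros k x. rewrite E. apply H.
Qed.

Lemma definable_sat (I : Type) phi (s : nat -> I) :
  definable (fun k x => sat (M k) (fun v => x (s v)) phi).
Proof. exists phi, s. tauto. Qed.

Lemma definable_ren (I J : Type) (t : I -> J) {P : forall k, (I -> M k) -> Prop} :
  definable P -> definable (fun k (x : J -> M k) => P k (fun i => x (t i))).
Proof.
  intros (phi & s & H). exists phi, (fun v => t (s v)). intros k x. apply H.
Qed.

Lemma definable_nat (P : forall k, (nat -> M k) -> Prop) :
  definable P -> exists phi, forall k x, P k x <-> sat (M k) x phi.
Proof.
  intros (phi & s & H). destruct (rename phi s) as [p Hp].
  exists p. intros k x. rewrite Hp. apply H.
Qed.

Lemma definable_eq (I : Type) (i j : I) : definable (fun k x => x i = x j).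
Proof.
  exists (fEq (tvar 0) (tvar 1)), (fun v => match v with 0 => i | _ => j end).
  simpl. tauto.
Qed.

Lemma definable_not (I : Type) {P : forall k, (I -> M k) -> Prop} :
  definable P -> definable (fun k x => ~ P k x).
Proof.
  intros (phi & s & H). exists (fNot phi), s. intros k x. simpl. rewrite H. tauto.
Qed.

(** The substitutions [s] and [t] may disagree on a common variable. Moving one formula to the even
    variables and the other to the odd ones lets [pairenv s t] serve both. *)
Lemma definable_and (I : Type) {P Q : forall k, (I -> M k) -> Prop} :
  definable P -> definable Q -> definable (fun k x => P k x /\ Q k x).
Proof.
  intros (phi & s & H) (psi & t & H').
  destruct (rename phi (fun v => 2 * v)) as [p Hp].
  destruct (rename psi (fun v => 2 * v + 1)) as [q Hq].
  exists (fAnd p q), (pairenv s t). intros k x. simpl sat.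
  rewrite Hp, Hq, H, H'.
  assert (E1 : (fun v => x (pairenv s t (2 * v))) = fun v => x (s v))
    by (apply functional_extensionality; intros v; rewrite pairenv_even; reflexivity).
  assert (E2 : (fun v => x (pairenv s t (2 * v + 1))) = fun v => x (t v))
    by (apply functional_extensionality; intros v; rewrite pairenv_odd; reflexivity).
  rewrite E1, E2. tauto.
Qed.

(** The index [i] is there because a definition contains a map [nat -> I], which an empty [I] does
    not admit. *)
Lemma definable_true (I : Type) (i : I) : definable (fun k (x : I -> M k) => True).
Proof. eapply definable_ext; [apply (definable_eq i i)|]. tauto. Qed.

Lemma definable_imp (I : Type) {P Q : forall k, (I -> M k) -> Prop} :
  definable P -> definable Q -> definable (fun k x => P k x -> Q k x).
Proof.
  intros HP HQ. eapply definable_ext.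
  - apply definable_not. apply (definable_and HP (definable_not HQ)).
  - intros k x. simpl. destruct (classic (Q k x)); tauto.
Qed.

(** [A] depends neither on the structure nor on the tuple, so excluded middle settles it before a
    formula is chosen. *)
Lemma definable_if (I : Type) (A : Prop) {P : forall k, (I -> M k) -> Prop} :
  definable P -> definable (fun k x => A -> P k x).
Proof.
  intros HP. destruct (classic A) as [HA|HA].
  - apply (definable_ext HP). tauto.
  - pose proof HP as (_ & s & _).
    apply (definable_ext (definable_true (s 0))). tauto.
Qed.

Lemma definable_lt (I : Type) (i : I) n (P : nat -> forall k, (I -> M k) -> Prop) :
  (forall j, definable (P j)) -> definable (fun k x => forall j, j < n -> P j k x).
Proof.
  intros H. induction n as [|n IH].
  - apply (definable_ext (definable_true i)). split; [auto|intros _ j Hj; lia].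
  - apply (definable_ext (definable_and (H n) IH)). intros k x. split.
    + intros Hx. split; auto.
    + intros [Hn Hx] j Hj. destruct (Nat.eq_dec j n) as [->|]; auto. apply Hx. lia.
Qed.

Lemma definable_in (I A : Type) (i : I) (l : list A) (P : A -> forall k, (I -> M k) -> Prop) :
  (forall j, definable (P j)) -> definable (fun k x => forall j, In j l -> P j k x).
Proof.
  intros H. induction l as [|a l IH].
  - apply (definable_ext (definable_true i)). simpl. tauto.
  - apply (definable_ext (definable_and (H a) IH)). intros k x. simpl. split.
    + intros Hx. split; auto.
    + intros [Hn Hx] j [->|Hj]; auto.
Qed.

Lemma definable_fin (I : Type) (i : I) n (P : Fin.t n -> forall k, (I -> M k) -> Prop) :
  (forall j, definable (P j)) -> definable (fun k x => forall j, P j k x).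
Proof.
  intros H. induction n as [|n IH].
  - apply (definable_ext (definable_true i)). intros k x. split; [auto|].
    intros _ j. inversion j.
  - apply (definable_ext (definable_and (H Fin.F1) (IH (fun j => P (Fin.FS j)) (fun j => H _)))).
    intros k x. split.
    + intros Hx. split; auto.
    + intros [H1 Hx] j. pattern j. apply Fin.caseS'; auto.
Qed.

Definition join {A I J : Type} (x : I -> A) (y : J -> A) (s : I + J) : A :=
  match s with inl i => x i | inr j => y j end.

(* Distinct variables may stand for the same quantified coordinate, so they are
   quantified separately subject to the conjunction of the forced equalities. *)
Lemma definable_ex (I J : Type) (i : I) (P : forall k, (I -> M k) -> (J -> M k) -> Prop) :
  definable (fun k (z : I + J -> M k) => P k (fun i => z (inl i)) (fun j => z (inr j))) ->
  definable (fun k x => exists y, P k x y).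
Proof.
  intros (phi & s & H).
  destruct (fv_bound phi) as [n Hn].
  destruct (@definable_nat (fun k z => sat (M k) z phi /\
    forall v, v < n -> forall w, w < n -> s v = s w -> z v = z w)) as [psi Hpsi].
  { apply definable_and; [apply (definable_sat phi (fun v => v))|].
    apply definable_lt; [exact 0|]. intros v. apply definable_lt; [exact 0|].
    intros w. apply definable_if. apply definable_eq. }
  set (l := filter (fun v => match s v with inr _ => true | _ => false end) (seq 0 n)).
  exists (exs l psi), (fun v => match s v with inl i => i | inr _ => i end).
  intros k x. rewrite sat_exs.
  assert (E : forall y, P k x y <-> sat (M k) (fun v => join x y (s v)) phi)
    by (intros y; exact (H k (join x y))).
  split.
  - intros [y Hy]. apply E in Hy.
    (* From [n] on the old environment is kept, since [exs l] may change only the variables in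
       [l]. *)
    exists (fun v => if v <? n then join x y (s v)
                     else x (match s v with inl i => i | inr _ => i end)).
    split.
    + intros v Hv. destruct (Nat.ltb_spec v n) as [Hvn|]; [|reflexivity].
      destruct (s v) eqn:Es; [reflexivity|]. exfalso. apply Hv.
      apply filter_In. rewrite Es. split; [apply in_seq; lia|reflexivity].
    + apply Hpsi. split.
      * revert Hy. apply sat_below with n; [exact Hn|]. intros v Hv.
        apply Nat.ltb_lt in Hv. rewrite Hv. reflexivity.
      * intros v Hv w Hw Es. apply Nat.ltb_lt in Hv, Hw. rewrite Hv, Hw, Es. reflexivity.
  - intros (z & Hz & Hs). apply Hpsi in Hs. destruct Hs as [Hs He].
    (* By [He] all variables standing for the coordinate [j] have one value; the coordinates that
       the formula does not mention, possibly infinitely many, get an arbitrary element. *)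
    destruct (@choice_fun J (M k)
      (fun j m => forall w, w < n -> s w = inr j -> z w = m)) as [y Hy].
    { intros j. destruct (classic (exists w, w < n /\ s w = inr j)) as [(w & Hw & Ew)|Hno].
      - exists (z w). intros w' Hw' Ew'. apply He; congruence.
      - exists (inhab (M k)). intros w Hw Ew. exfalso. eauto. }
    exists y. apply E. revert Hs. apply sat_below with n; [exact Hn|].
    intros v Hv. destruct (s v) as [i'|j] eqn:Es; simpl.
    + rewrite Hz, Es; [reflexivity|]. intros Hin. apply filter_In in Hin.
      rewrite Es in Hin. destruct Hin as [_ Hin]. discriminate.
    + auto.
Qed.

Lemma definable_ex1 (I : Type) (i : I) (P : forall k, (I -> M k) -> M k -> Prop) :
  definable (fun k (z : option I -> M k) => P k (fun i => z (Some i)) (z None)) ->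
  definable (fun k x => exists y, P k x y).
Proof.
  intros H. apply (@definable_ext _ (fun k x => exists y : unit -> M k, P k x (y tt))).
  - apply (definable_ex i (fun k x (y : unit -> M k) => P k x (y tt))).
    exact (definable_ren (fun o => match o with Some i => inl i | None => inr tt end) H).
  - intros k x. split; intros [y Hy]; [exists (fun _ => y)|exists (y tt)]; exact Hy.
Qed.

Lemma definable_all1 (I : Type) (i : I) (P : forall k, (I -> M k) -> M k -> Prop) :
  definable (fun k (z : option I -> M k) => P k (fun i => z (Some i)) (z None)) ->
  definable (fun k x => forall y, P k x y).
Proof.
  intros H. eapply definable_ext.
  - apply definable_not. apply (definable_ex1 i (fun k x y => ~ P k x y)).
    apply definable_not. exact H.
  - intros k x. simpl. split.
    + intros Hx [y Hy]. auto.
    + intros Hx y. apply NNPP. eauto.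
Qed.

End Definable.

(** * Pulling back along an interpretation *)

Lemma idom_ext (L L' : language) (G : interp L L') (M : structure L) (x y : nat -> M) :
  interp_wf G -> (forall c, c < idim G -> x c = y c) ->
  sat M x (idom G) -> sat M y (idom G).
Proof.
  intros (Hd & _) E. apply sat_below with (idim G); auto.
Qed.

(** [pi x = pi x] means that [ieq] holds of the pair [x], [x]; as [ieq] reads only the first
    [idim G] entries of each block, the second [x] may be replaced by [y]. *)
Lemma interprets_ext (L L' : language) (G : interp L L') (M : structure L)
  (N : structure L') (pi : (nat -> M) -> N) (x y : nat -> M) :
  interp_wf G -> interprets G M N pi -> (forall c, c < idim G -> x c = y c) ->
  sat M x (idom G) -> pi x = pi y.
Proof.
  intros Hwf (_ & Heq & _) E Hx.
  apply Heq; [exact Hx|exact (idom_ext M x y Hwf E Hx)|].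
  assert (H : pi x = pi x) by reflexivity.
  apply Heq in H; [|exact Hx..]. revert H.
  destruct Hwf as (_ & He & _). apply sat_below with (2 * idim G); [exact He|].
  intros v Hv. apply blockenv_lt in Hv. destruct Hv as [_ Hv].
  unfold blockenv, pair2. destruct (v / idim G); auto.
Qed.

Section Pullback.
Context {L L' : language} {K : Type} {M : K -> structure L} {N : K -> structure L'}.
Variable G : interp L L'.
Variable pi : forall k, (nat -> M k) -> N k.
Hypothesis HG : forall k, interprets G (M k) (N k) (@pi k).

(** The clauses of [interprets] want every block of an infinite sequence in the domain, so the
    blocks beyond the first [n] are filled with representatives of an arbitrary element. *)
Lemma fin_representatives k n (g : Fin.t n -> N k) :
  exists ys : nat -> nat -> M k, (forall j, sat (M k) (fun c => ys j c) (idom G)) /\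
    forall i, pi k (fun c => ys (finidx i) c) = g i.
Proof.
  destruct (HG k) as (Hsurj & _).
  destruct (@choice_fun nat (nat -> M k) (fun j y => sat (M k) y (idom G) /\
    forall i, finidx i = j -> pi k y = g i)) as [ys Hys].
  - intros j. destruct (classic (exists i : Fin.t n, finidx i = j)) as [[i Hi]|Hno].
    + destruct (Hsurj (g i)) as (y & Hy & E). exists y. split; auto. intros i' Hi'.
      replace i' with i; auto. apply Fin.to_nat_inj. exact (eq_trans Hi (eq_sym Hi')).
    + destruct (Hsurj (inhab (N k))) as (y & Hy & _).
      exists y. split; auto. intros i Hi. exfalso. eauto.
  - exists ys. split; [intros j; apply Hys|]. intros i. apply Hys. reflexivity.
Qed.

(** Function symbols are interpreted through their graphs, so a term becomes a relation between
    representatives of its variables, at [inl (v, c)], and a representative of its value, at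
    [inr c]. *)
Lemma pullback_term (t : term L') :
  exists P : forall k, (nat * nat + nat -> M k) -> Prop, definable M P /\
  forall k (x : nat * nat -> M k) (y : nat -> M k),
    (forall v, sat (M k) (fun c => x (v, c)) (idom G)) -> sat (M k) y (idom G) ->
    (P k (join x y) <-> teval (N k) (fun v => pi k (fun c => x (v, c))) t = pi k y).
Proof.
  induction t as [v|f ts IH].
  - exists (fun k z => sat (M k) (blockenv (idim G)
        (pair2 (fun c => z (inl (v, c))) (fun c => z (inr c)))) (ieq G)).
    split.
    + eapply definable_ext; [apply (definable_sat M (ieq G)
        (fun w => match w / idim G with 0 => inl (v, w mod idim G) | _ => inr (w mod idim G) end))|].
      intros k z. simpl.
      match goal with |- sat _ ?a _ <-> sat _ ?b _ => replace a with b; [tauto|] end.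
      apply functional_extensionality. intros w. unfold blockenv, pair2.
      destruct (w / idim G); reflexivity.
    + intros k x y Hx Hy. destruct (HG k) as (_ & Heq & _). symmetry.
      apply (Heq (fun c => x (v, c)) y); auto.
  - apply choice_fun in IH. destruct IH as [P HP].
    set (n := farity L' f).
    (* The blocks [ys] represent the values of the arguments. Block [n] is the value of the whole
       term, and it is repeated afterwards so that all blocks lie in the domain. *)
    exists (fun k z => exists ys : nat * nat -> M k,
      ((forall j, j < n -> sat (M k) (fun c => ys (j, c)) (idom G)) /\
       (forall i, P i k (join (fun p => z (inl p)) (fun c => ys (finidx i, c))))) /\
      sat (M k) (blockenv (idim G)
        (fun j => if j <? n then fun c => ys (j, c) else fun c => z (inr c))) (ifun G f)).
    split.
    + apply definable_ex; [exact (inr 0)|]. apply definable_and; [apply definable_and|].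
      * apply definable_lt; [exact (inr (0, 0))|]. intros j.
        apply (definable_sat M (idom G) (fun c => inr (j, c))).
      * apply definable_fin; [exact (inr (0, 0))|]. intros i.
        destruct (HP i) as [HPi _].
        apply (definable_ext (definable_ren (fun s => match s with
          inl p => inl (inl p) | inr c => inr (finidx i, c) end) HPi)).
        intros k z. match goal with |- P i k ?a <-> P i k ?b => replace a with b; [tauto|] end.
        apply functional_extensionality. intros [p|c]; reflexivity.
      * eapply definable_ext; [apply (definable_sat M (ifun G f)
          (fun w => if w / idim G <? n then inr (w / idim G, w mod idim G)
                    else inl (inr (w mod idim G))))|].
        intros k z. simpl.
        match goal with |- sat _ ?a _ <-> sat _ ?b _ => replace a with b; [tauto|] end.
        apply functional_extensionality. intros w. unfold blockenv.
        destruct (w / idim G <? n); reflexivity.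
    + intros k x y Hx Hy. destruct (HG k) as (Hsurj & _ & _ & Hfun).
      assert (Hkey : forall ys : nat * nat -> M k,
        (forall j, j < n -> sat (M k) (fun c => ys (j, c)) (idom G)) ->
        (forall i, pi k (fun c => ys (finidx i, c)) =
                   teval (N k) (fun v => pi k (fun c => x (v, c))) (ts i)) ->
        (sat (M k) (blockenv (idim G)
           (fun j => if j <? n then fun c => ys (j, c) else y)) (ifun G f) <->
         teval (N k) (fun v => pi k (fun c => x (v, c))) (tapp f ts) = pi k y)).
      { intros ys Hys Hpi.
        rewrite <- (Hfun f (fun j => if j <? n then fun c => ys (j, c) else y)).
        - fold n. rewrite Nat.ltb_irrefl. simpl.
          replace (fun i : Fin.t n => pi k (if finidx i <? n then fun c => ys (finidx i, c) else y))
            with (fun i => teval (N k) (fun v => pi k (fun c => x (v, c))) (ts i)); [tauto|].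
          apply functional_extensionality. intros i.
          pose proof (finidx_lt i) as Hi. apply Nat.ltb_lt in Hi. fold n in Hi. rewrite Hi. auto.
        - intros j. destruct (Nat.ltb_spec j n); auto. }
      split.
      * intros (ys & (Hys & HPs) & Hs). apply (Hkey ys); auto.
        intros i. symmetry. apply (proj2 (HP i) k x (fun c => ys (finidx i, c))); auto.
        apply Hys. apply finidx_lt.
      * intros Ht.
        destruct (fin_representatives k (fun i =>
          teval (N k) (fun v => pi k (fun c => x (v, c))) (ts i))) as (ys & Hd & Hp).
        exists (fun p => ys (fst p) (snd p)). simpl.
        repeat split.
        -- auto.
        -- intros i. apply (proj2 (HP i) k x (fun c => ys (finidx i) c)); auto.
        -- apply (Hkey (fun p => ys (fst p) (snd p))); simpl; auto.
Qed.

Lemma pullback_formula (psi : formula L') :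
  exists P : forall k, (nat * nat -> M k) -> Prop, definable M P /\
  forall k (x : nat * nat -> M k),
    (forall v, sat (M k) (fun c => x (v, c)) (idom G)) ->
    (P k x <-> sat (N k) (fun v => pi k (fun c => x (v, c))) psi).
Proof.
  induction psi as [t1 t2|r ts|psi IH|psi1 IH1 psi2 IH2|w psi IH].
  - destruct (pullback_term t1) as (P1 & D1 & H1), (pullback_term t2) as (P2 & D2 & H2).
    exists (fun k x => exists y : nat -> M k,
      sat (M k) y (idom G) /\ P1 k (join x y) /\ P2 k (join x y)).
    split.
    + apply definable_ex; [exact (0, 0)|]. apply definable_and; [|apply definable_and].
      * apply (definable_sat M (idom G) inr).
      * apply (definable_ext D1). intros k z.
        replace (join (fun i => z (inl i)) (fun j => z (inr j))) with z; [tauto|].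
        apply functional_extensionality. intros [?|?]; reflexivity.
      * apply (definable_ext D2). intros k z.
        replace (join (fun i => z (inl i)) (fun j => z (inr j))) with z; [tauto|].
        apply functional_extensionality. intros [?|?]; reflexivity.
    + intros k x Hx. simpl. split.
      * intros (y & Hy & A1 & A2). apply H1 in A1; auto. apply H2 in A2; auto. congruence.
      * intros E. destruct (HG k) as (Hsurj & _).
        destruct (Hsurj (teval (N k) (fun v => pi k (fun c => x (v, c))) t1)) as (y & Hy & Ey).
        exists y. split; auto. split; [apply H1|apply H2]; auto; congruence.
  - destruct (choice_fun _ (fun i => pullback_term (ts i))) as [P HP].
    (* The part [inl] of [z] represents the arguments; the part [inr] is one block of the domain
       that pads the positions from the arity on. *)
    exists (fun k x => exists z : nat * nat + nat -> M k,
      (sat (M k) (fun c => z (inr c)) (idom G) /\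
       (forall j, j < rarity L' r -> sat (M k) (fun c => z (inl (j, c))) (idom G)) /\
       (forall i, P i k (join x (fun c => z (inl (finidx i, c)))))) /\
      sat (M k) (blockenv (idim G)
        (fun j => if j <? rarity L' r then fun c => z (inl (j, c)) else fun c => z (inr c))) (irel G r)).
    split.
    + apply definable_ex; [exact (0, 0)|].
      apply definable_and; [apply definable_and; [|apply definable_and]|].
      * apply (definable_sat M (idom G) (fun c => inr (inr c))).
      * apply definable_lt; [exact (inl (0, 0))|]. intros j.
        apply (definable_sat M (idom G) (fun c => inr (inl (j, c)))).
      * apply definable_fin; [exact (inl (0, 0))|]. intros i.
        destruct (HP i) as [HPi _].
        apply (definable_ext (definable_ren (fun s => match s with
          inl p => inl p | inr c => inr (inl (finidx i, c)) end) HPi)).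
        intros k z. match goal with |- P i k ?a <-> P i k ?b => replace a with b; [tauto|] end.
        apply functional_extensionality. intros [p|c]; reflexivity.
      * eapply definable_ext; [apply (definable_sat M (irel G r)
          (fun w => if w / idim G <? rarity L' r then inr (inl (w / idim G, w mod idim G))
                    else inr (inr (w mod idim G))))|].
        intros k z. simpl.
        match goal with |- sat _ ?a _ <-> sat _ ?b _ => replace a with b; [tauto|] end.
        apply functional_extensionality. intros w. unfold blockenv.
        destruct (w / idim G <? rarity L' r); reflexivity.
    + intros k x Hx. destruct (HG k) as (Hsurj & _ & Hrel & _).
      assert (Hkey : forall z : nat * nat + nat -> M k,
        sat (M k) (fun c => z (inr c)) (idom G) ->
        (forall j, j < rarity L' r -> sat (M k) (fun c => z (inl (j, c))) (idom G)) ->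
        (forall i, pi k (fun c => z (inl (finidx i, c))) =
                   teval (N k) (fun v => pi k (fun c => x (v, c))) (ts i)) ->
        (sat (M k) (blockenv (idim G)
           (fun j => if j <? rarity L' r then fun c => z (inl (j, c)) else fun c => z (inr c))) (irel G r) <->
         sat (N k) (fun v => pi k (fun c => x (v, c))) (fRel r ts))).
      { intros z Hz Hys Hpi.
        rewrite <- (Hrel r (fun j => if j <? rarity L' r then fun c => z (inl (j, c)) else fun c => z (inr c))).
        - simpl.
          match goal with |- rels _ _ ?a <-> rels _ _ ?b => replace a with b; [tauto|] end.
          apply functional_extensionality. intros i.
          pose proof (finidx_lt i) as Hi. apply Nat.ltb_lt in Hi.  rewrite Hi. auto.
        - intros j. destruct (Nat.ltb_spec j (rarity L' r)); auto. }
      split.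
      * intros (z & (Hz & Hys & HPs) & Hs). apply (Hkey z); auto.
        intros i. symmetry. apply (proj2 (HP i) k x (fun c => z (inl (finidx i, c)))); auto.
        apply Hys. apply finidx_lt.
      * intros Ht.
        destruct (fin_representatives k (fun i =>
          teval (N k) (fun v => pi k (fun c => x (v, c))) (ts i))) as (ys & Hd & Hp).
        (* Any block in the domain can serve as padding; that of variable [0] is at hand. *)
        exists (join (fun p => ys (fst p) (snd p)) (fun c => x (0, c))). simpl.
        repeat split; auto.
        -- intros i. apply (proj2 (HP i) k x (fun c => ys (finidx i) c)); auto.
        -- apply (Hkey (join (fun p => ys (fst p) (snd p)) (fun c => x (0, c)))); simpl; auto.
  - destruct IH as (P & D & H). exists (fun k x => ~ P k x).
    split; [apply (definable_not D)|]. intros k x Hx. simpl. rewrite (H k x Hx). tauto.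
  - destruct IH1 as (P & D & H), IH2 as (P' & D' & H').
    exists (fun k x => P k x /\ P' k x).
    split; [apply (definable_and D D')|]. intros k x Hx. simpl.
    rewrite (H k x Hx), (H' k x Hx). tauto.
  - destruct IH as (P & D & H).
    exists (fun k x => exists y : nat -> M k, sat (M k) y (idom G) /\
      P k (fun p => if fst p =? w then y (snd p) else x p)).
    split.
    + apply definable_ex; [exact (0, 0)|]. apply definable_and.
      * apply (definable_sat M (idom G) inr).
      * apply (definable_ext (definable_ren
          (fun p => if fst p =? w then inr (snd p) else inl p) D)).
        intros k z. match goal with |- P k ?a <-> P k ?b => replace a with b; [tauto|] end.
        apply functional_extensionality. intros p. destruct (fst p =? w); reflexivity.
    + intros k x Hx. simpl.
      assert (E : forall y, sat (M k) y (idom G) ->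
        (P k (fun p => if fst p =? w then y (snd p) else x p) <->
         sat (N k) (upd (fun v => pi k (fun c => x (v, c))) w (pi k y)) psi)).
      { intros y Hy. rewrite H.
        - match goal with |- sat _ ?a _ <-> sat _ ?b _ => replace a with b; [tauto|] end.
          apply functional_extensionality. intros v. unfold upd. simpl.
          destruct (v =? w); reflexivity.
        - intros v. simpl. destruct (v =? w); auto. }
      split.
      * intros (y & Hy & Hs). exists (pi k y). apply E; auto.
      * intros [m Hm]. destruct (HG k) as (Hsurj & _). destruct (Hsurj m) as (y & Hy & <-).
        exists y. split; auto. apply E; auto.
Qed.

(* Only the coordinates in [S], the ones that [Q] depends on, need representatives in
   the domain: the others are replaced by an arbitrary element of it. *)
Lemma pullback (J : Type) (S : J -> bool) (Q : forall k, (J -> N k) -> Prop) :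
  definable N Q ->
  (forall k y y', (forall j, S j = true -> y j = y' j) -> Q k y -> Q k y') ->
  exists P : forall k, (J * nat -> M k) -> Prop, definable M P /\
  forall k (x : J * nat -> M k),
    (forall j, S j = true -> sat (M k) (fun c => x (j, c)) (idom G)) ->
    (P k x <-> Q k (fun j => pi k (fun c => x (j, c)))).
Proof.
  intros (psi & s & HQ) HS. destruct (pullback_formula psi) as (P & D & HP).
  exists (fun k x => exists z : nat -> M k, sat (M k) z (idom G) /\
    P k (fun p => if S (s (fst p)) then x (s (fst p), snd p) else z (snd p))).
  split.
  - apply definable_ex; [exact (s 0, 0)|]. apply definable_and.
    + apply (definable_sat M (idom G) inr).
    + apply (definable_ext (definable_ren
        (fun p => if S (s (fst p)) then inl (s (fst p), snd p) else inr (snd p)) D)).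
      intros k z. match goal with |- P k ?a <-> P k ?b => replace a with b; [tauto|] end.
      apply functional_extensionality. intros p. destruct (S (s (fst p))); reflexivity.
  - intros k x Hx.
    assert (E : forall z, sat (M k) z (idom G) ->
      (P k (fun p => if S (s (fst p)) then x (s (fst p), snd p) else z (snd p)) <->
       Q k (fun j => pi k (fun c => x (j, c))))).
    { intros z Hz. rewrite HP.
      - transitivity (Q k (fun j => pi k (fun c => if S j then x (j, c) else z c))).
        + symmetry. apply HQ.
        + split; apply HS; intros j Hj; rewrite Hj; reflexivity.
      - intros v. simpl. destruct (S (s v)) eqn:Es; auto. }
    split.
    + intros (z & Hz & Hs). apply (E z); auto.
    + intros Hs. destruct (HG k) as (Hsurj & _).
      destruct (Hsurj (inhab (N k))) as (z & Hz & _).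
      exists z. split; auto. apply E; auto.
Qed.

End Pullback.

(** * Definability of the composite coordinate maps *)

(** The condition that [definable_composite] imposes on [chi], with the identity in place of the
    isomorphism [h]. *)
Definition composite_graph {L L' : language} {M : structure L} {N : structure L'}
  (G : interp L L') (Dl : interp L' L) (pi : (nat -> M) -> N) (rho : (nat -> N) -> M)
  (m : M) (z : nat * nat -> M) : Prop :=
  (forall j, j < idim Dl -> sat M (fun c => z (j, c)) (idom G)) /\
  sat N (fun j => pi (fun c => z (j, c))) (idom Dl) /\
  m = rho (fun j => pi (fun c => z (j, c))).

Definition composite_definable {L L' : language} {K : Type}
  {M : K -> structure L} {N : K -> structure L'} (G : interp L L') (Dl : interp L' L)
  (pi : forall k, (nat -> M k) -> N k) (rho : forall k, (nat -> N k) -> M k) : Prop :=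
  definable M (fun k (x : option (nat * nat) -> M k) =>
    composite_graph G Dl (@pi k) (@rho k) (x None) (fun p => x (Some p))).

Lemma composite_graph_ext (L L' : language) (M : structure L) (N : structure L')
  (G : interp L L') (Dl : interp L' L) (pi : (nat -> M) -> N) (rho : (nat -> N) -> M)
  m (z z' : nat * nat -> M) :
  interp_wf G -> interp_wf Dl -> interprets G M N pi -> interprets Dl N M rho ->
  (forall j c, j < idim Dl -> c < idim G -> z (j, c) = z' (j, c)) ->
  composite_graph G Dl pi rho m z -> composite_graph G Dl pi rho m z'.
Proof.
  intros HwG HwD HG HD E (H1 & H2 & H3).
  assert (E' : forall j, j < idim Dl ->
    pi (fun c => z (j, c)) = pi (fun c => z' (j, c))).
  { intros j Hj. apply (interprets_ext _ _ HwG HG); auto. }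
  split; [|split].
  - intros j Hj. apply idom_ext with (fun c => z (j, c)); auto.
  - apply idom_ext with (fun j => pi (fun c => z (j, c))); auto.
  - rewrite H3. apply (interprets_ext _ _ HwD HD); auto.
Qed.

Section Composite.
Context {L L' : language} {K : Type} {M : K -> structure L} {N : K -> structure L'}.
Variables (G : interp L L') (Dl : interp L' L).
Variable pi : forall k, (nat -> M k) -> N k.
Variable rho : forall k, (nat -> N k) -> M k.
Hypothesis wfG : interp_wf G.
Hypothesis wfDl : interp_wf Dl.
Hypothesis HG : forall k, interprets G (M k) (N k) (@pi k).
Hypothesis HDl : forall k, interprets Dl (N k) (M k) (@rho k).
Hypothesis Hchi : composite_definable G Dl pi rho.
(** [h] is the twist left over on the side of [N]: the formula available there defines [pi o rho]
    followed by the inverse of [h]. The section removes the twist by defining [h]. *)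
Variable h : forall k, N k -> N k.
Hypothesis h_inj : forall k x y, h k x = h k y -> x = y.
Hypothesis h_surj : forall k y, exists x, h k x = y.
Hypothesis Hchi' : definable N (fun k (y : option (nat * nat) -> N k) =>
  composite_graph Dl G (@rho k) (@pi k) (h k (y None)) (fun p => y (Some p))).

Lemma composite_representative k (n : N k) : exists z : nat * nat -> N k,
  composite_graph Dl G (@rho k) (@pi k) n z.
Proof.
  destruct (HG k) as (HsG & _). destruct (HDl k) as (HsD & _).
  destruct (HsG n) as (x & Hx & <-).
  destruct (choice_fun _ (fun c => HsD (x c))) as [z Hz].
  exists (fun p => z (fst p) (snd p)). simpl.
  assert (Ez : x = fun c => rho k (fun i => z c i)).
  { apply functional_extensionality. intros c. symmetry. apply Hz. }
  repeat split; simpl.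
  - intros c _. apply Hz.
  - rewrite <- Ez. exact Hx.
  - rewrite <- Ez. reflexivity.
Qed.

(** Pulled back to [M], the twisted graph expresses [h (pi x) = pi (rho (pi w))]. In [M] the inner
    [rho o pi] is definable by [Hchi], so it can be evaluated and its value compared, through [ieq],
    with a representative of the alleged image. *)
Lemma twist_definable_below :
  definable M (fun k (x : bool * nat -> M k) =>
    (sat (M k) (fun c => x (true, c)) (idom G) /\
     sat (M k) (fun c => x (false, c)) (idom G)) /\
    h k (pi k (fun c => x (true, c))) = pi k (fun c => x (false, c))).
Proof.
  destruct (pullback _ HG (fun o => match o with
    | None => true | Some (c, i) => (c <? idim G) && (i <? idim Dl) end) Hchi')
    as (Q & DQ & HQ).
  { intros k y y' E. simpl. rewrite (E None eq_refl).
    apply composite_graph_ext; auto. intros c i Hc Hi. apply E.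
    apply andb_true_intro. split; apply Nat.ltb_lt; assumption. }
  (* [z (inl (c, i, b))] is entry [b] of a representative of argument [i] of the [c]-th application
     of [rho], and [z (inr c)] is the value of that application. *)
  set (P := fun k (x : bool * nat -> M k) => exists z : nat * nat * nat + nat -> M k,
    ((forall c, c < idim G -> forall i, i < idim Dl ->
        sat (M k) (fun b => z (inl (c, i, b))) (idom G)) /\
     Q k (fun q => match fst q with
                   | None => x (true, snd q) | Some p => z (inl (p, snd q)) end)) /\
    ((forall c, c < idim G -> composite_graph G Dl (@pi k) (@rho k)
        (z (inr c)) (fun p => z (inl (c, fst p, snd p)))) /\
     sat (M k) (blockenv (idim G)
       (pair2 (fun b => x (false, b)) (fun b => z (inr b)))) (ieq G))).
  assert (DP : definable M P).
  { apply definable_ex; [exact (true, 0)|].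
    apply definable_and; apply definable_and.
    - apply definable_lt; [exact (inl (true, 0))|]. intros c.
      apply definable_lt; [exact (inl (true, 0))|]. intros i.
      apply (definable_sat M (idom G) (fun b => inr (inl (c, i, b)))).
    - apply (definable_ext (definable_ren (fun q => match fst q with
        | None => inl (true, snd q) | Some p => inr (inl (p, snd q)) end) DQ)).
      intros k z. match goal with |- Q k ?a <-> Q k ?b => replace a with b; [tauto|] end.
      apply functional_extensionality. intros [[p|] b]; reflexivity.
    - apply definable_lt; [exact (inl (true, 0))|]. intros c.
      apply (definable_ren (fun o => match o with
        | None => inr (inr c) | Some p => inr (inl (c, fst p, snd p)) end) Hchi).
    - eapply definable_ext; [apply (definable_sat M (ieq G)
        (fun w => match w / idim G with
                  | 0 => inl (false, w mod idim G) | _ => inr (inr (w mod idim G)) end))|].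
      intros k z. simpl.
      match goal with |- sat _ ?a _ <-> sat _ ?b _ => replace a with b; [tauto|] end.
      apply functional_extensionality. intros w. unfold blockenv, pair2.
      destruct (w / idim G); reflexivity. }
  assert (HP : forall k (x : bool * nat -> M k),
    sat (M k) (fun c => x (true, c)) (idom G) ->
    sat (M k) (fun c => x (false, c)) (idom G) ->
    (P k x <-> h k (pi k (fun c => x (true, c))) = pi k (fun c => x (false, c)))).
  { intros k x Ht Hf. destruct (HG k) as (Hsurj & Heq & _).
    assert (HQx : forall z : nat * nat * nat + nat -> M k,
      (forall c, c < idim G -> forall i, i < idim Dl ->
        sat (M k) (fun b => z (inl (c, i, b))) (idom G)) ->
      (Q k (fun q => match fst q with
                   | None => x (true, snd q) | Some p => z (inl (p, snd q)) end) <->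
       composite_graph Dl G (@rho k) (@pi k) (h k (pi k (fun c => x (true, c))))
         (fun p => pi k (fun b => z (inl (p, b)))))).
    { intros z Hz. apply HQ. intros [[c i]|] Ho; simpl; [|exact Ht].
      apply andb_prop in Ho. destruct Ho as [Hc Hi]. apply Nat.ltb_lt in Hc, Hi. auto. }
    split.
    - intros (z & (Hz & HQz) & HC & He).
      apply HQx in HQz; [|exact Hz]. destruct HQz as (H1 & H2 & H3). rewrite H3.
      assert (Em : forall c, c < idim G ->
        rho k (fun i => pi k (fun b => z (inl (c, i, b)))) = z (inr c)).
      { intros c Hc. destruct (HC c Hc) as (_ & _ & E). symmetry. exact E. }
      rewrite (interprets_ext _ (fun c => z (inr c)) wfG (HG k) Em H2).
      symmetry. apply Heq; auto. exact (idom_ext _ _ _ wfG Em H2).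
    - intros E.
      (* Each entry of the second tuple is written as [rho] of elements of [N], and these as [pi] of
         tuples of [M]. *)
      destruct (HDl k) as (HsD & _).
      destruct (choice_fun _ (fun c => HsD (x (false, c)))) as [z Hz].
      destruct (choice_fun _ (fun p : nat * nat => Hsurj (z (fst p) (snd p)))) as [w Hw].
      assert (Ew : forall c, (fun i => pi k (fun b => w (c, i) b)) = z c).
      { intros c. apply functional_extensionality. intros i. apply (Hw (c, i)). }
      assert (Er : (fun c => rho k (fun i => pi k (fun b => w (c, i) b)))
                   = fun c => x (false, c)).
      { apply functional_extensionality. intros c. rewrite Ew. apply Hz. }
      exists (join (fun q => w (fst q) (snd q)) (fun c => x (false, c))).
      split; [split|split]; simpl.
      + intros c _ i _. apply Hw.
      + apply (HQx (join (fun q => w (fst q) (snd q)) (fun c => x (false, c))));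
          simpl; [intros c _ i _; apply Hw|].
        split; [|split]; simpl.
        * intros c _. rewrite Ew. apply Hz.
        * rewrite Er. exact Hf.
        * rewrite Er. exact E.
      + intros c _. split; [|split]; simpl.
        * intros i _. apply Hw.
        * rewrite Ew. apply Hz.
        * rewrite Ew. symmetry. apply Hz.
      + apply (proj1 (Heq _ _ Hf Hf)). reflexivity. }
  refine (definable_ext (definable_and (definable_and
    (definable_sat M (idom G) (fun c => (true, c)))
    (definable_sat M (idom G) (fun c => (false, c)))) DP) _).
  intros k x. split; intros [[Ht Hf] H]; (split; [split; assumption|]); apply (HP k x Ht Hf) in H; exact H.
Qed.

(* The twist [h] is pulled back to [M] and read in [N] through representatives
   [pi (rho z) = h y]; as [h] commutes with itself, this again describes [h]. *)
Lemma twist_definable : definable N (fun k (y : bool -> N k) => h k (y true) = y false).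
Proof.
  destruct (pullback _ HDl (fun p => snd p <? idim G) twist_definable_below)
    as (R & DR & HR).
  { intros k x x' E [[Ht Hf] H].
    assert (Et : forall c, c < idim G -> x (true, c) = x' (true, c))
      by (intros c Hc; apply E; apply Nat.ltb_lt; exact Hc).
    assert (Ef : forall c, c < idim G -> x (false, c) = x' (false, c))
      by (intros c Hc; apply E; apply Nat.ltb_lt; exact Hc).
    split; [split|].
    - exact (idom_ext _ _ _ wfG Et Ht).
    - exact (idom_ext _ _ _ wfG Ef Hf).
    - rewrite <- (interprets_ext _ _ wfG (HG k) Et Ht).
      rewrite <- (interprets_ext _ _ wfG (HG k) Ef Hf). exact H. }
  apply (@definable_ext _ _ N _ (fun k (y : bool -> N k) =>
    exists z : bool * nat * nat -> N k,
    (composite_graph Dl G (@rho k) (@pi k) (h k (y true))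
       (fun p => z (true, fst p, snd p)) /\
     composite_graph Dl G (@rho k) (@pi k) (h k (y false))
       (fun p => z (false, fst p, snd p))) /\ R k z)).
  - apply definable_ex; [exact true|]. apply definable_and; [apply definable_and|].
    + apply (definable_ren (fun o => match o with
        None => inl true | Some p => inr (true, fst p, snd p) end) Hchi').
    + apply (definable_ren (fun o => match o with
        None => inl false | Some p => inr (false, fst p, snd p) end) Hchi').
    + exact (definable_ren inr DR).
  - intros k y.
    assert (Hz : forall z : bool * nat * nat -> N k,
      composite_graph Dl G (@rho k) (@pi k) (h k (y true))
       (fun p => z (true, fst p, snd p)) ->
      composite_graph Dl G (@rho k) (@pi k) (h k (y false))
       (fun p => z (false, fst p, snd p)) -> (R k z <-> h k (y true) = y false)).
    { intros z (H1 & H2 & H3) (F1 & F2 & F3). simpl in *. rewrite HR.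
      - rewrite <- H3, <- F3. split; [|intros ->; tauto].
        intros [_ E]. exact (h_inj E).
      - intros [[|] c] Hc; simpl in *; apply Nat.ltb_lt in Hc; auto. }
    split.
    + intros E.
      destruct (composite_representative k (h k (y true))) as (z & Hzt).
      destruct (composite_representative k (h k (y false))) as (z' & Hzf).
      exists (fun q => match q with
        | (true, c, i) => z (c, i) | (false, c, i) => z' (c, i) end).
      assert (H1 : composite_graph Dl G (@rho k) (@pi k) (h k (y true))
        (fun p => z (fst p, snd p))) by (revert Hzt; apply composite_graph_ext; auto).
      assert (H2 : composite_graph Dl G (@rho k) (@pi k) (h k (y false))
        (fun p => z' (fst p, snd p))) by (revert Hzf; apply composite_graph_ext; auto).
      split; [split; assumption|]. apply Hz; assumption.
    + intros (z & (H1 & H2) & H3). apply (Hz z); assumption.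
Qed.

(** Once [h] is definable, the twisted graph is applied at a preimage [n] of the given element under
    [h], which exists by surjectivity. *)
Lemma composite_definable_converse : composite_definable Dl G rho pi.
Proof.
  apply (@definable_ext _ _ N _ (fun k (y : option (nat * nat) -> N k) =>
    exists n, h k n = y None /\
      composite_graph Dl G (@rho k) (@pi k) (h k n) (fun p => y (Some p)))).
  - apply definable_ex1; [exact None|]. apply definable_and.
    + apply (definable_ren (fun b : bool => if b then None else Some None) twist_definable).
    + apply (definable_ren (fun o => match o with
        None => None | Some p => Some (Some p) end) Hchi').
  - intros k y. split.
    + intros H. destruct (h_surj k (y None)) as [n Hn]. exists n.
      rewrite Hn. split; [reflexivity|exact H].
    + intros (n & <- & H). exact H.
Qed.

End Composite.

(** * Rich sequences *)

(** This is [D_{Phi,n}], evaluated on infinite sequences although only the entries below [n] matter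
    to it when [Phi] is rich. *)
Definition D_upto {L : language} (Phi : nat -> formula L) (M : structure L) (n : nat)
  (a : nat -> M) : Prop :=
  forall k, k < n -> forall m : M,
    sat M (consenv m a) (Phi k) -> sat M (consenv (a k) a) (Phi k).

Lemma realises_D_upto (L : language) (Phi : nat -> formula L) (M : structure L) (a : nat -> M) :
  realises_D Phi M a <-> forall n, D_upto Phi M n a.
Proof.
  split.
  - intros H n k _. apply H.
  - intros H k. apply (H (S k)). lia.
Qed.

Lemma D_upto_le (L : language) (Phi : nat -> formula L) (M : structure L) n n' (a : nat -> M) :
  n <= n' -> D_upto Phi M n' a -> D_upto Phi M n a.
Proof. intros Hn H k Hk. apply H. lia. Qed.

Section Rich.
Context {L : language} {K : Type} {M : K -> structure L}.
Variable Phi : nat -> formula L.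
Hypothesis HPhi : rich Phi.

Lemma sat_consenv_ext (A : structure L) k (a a' : nat -> A) m :
  (forall i, i < k -> a i = a' i) ->
  sat A (consenv m a) (Phi k) -> sat A (consenv m a') (Phi k).
Proof.
  intros E. apply sat_below with (S k); [apply HPhi|].
  intros [|v] Hv; simpl; [reflexivity|]. apply E. lia.
Qed.

Lemma D_upto_ext (A : structure L) n (a a' : nat -> A) :
  (forall i, i < n -> a i = a' i) -> D_upto Phi A n a -> D_upto Phi A n a'.
Proof.
  intros E H k Hk m Hm. rewrite <- E by exact Hk.
  apply sat_consenv_ext with a; [intros i Hi; apply E; lia|].
  apply (H k Hk m). apply sat_consenv_ext with a'; [|exact Hm].
  intros i Hi. symmetry. apply E. lia.
Qed.

Lemma upd_below (A : Type) n (a : nat -> A) m i : i < n -> upd a n m i = a i.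
Proof.
  intros Hi. unfold upd. destruct (Nat.eqb_spec i n); [lia|reflexivity].
Qed.

Lemma D_upto_upd (A : structure L) n (a : nat -> A) m :
  D_upto Phi A n a ->
  (forall m', sat A (consenv m' a) (Phi n) -> sat A (consenv m a) (Phi n)) ->
  D_upto Phi A (S n) (upd a n m).
Proof.
  intros H Hm k Hk m' Hm'. destruct (Nat.eq_dec k n) as [->|Hne].
  - assert (E : upd a n m n = m) by (unfold upd; rewrite Nat.eqb_refl; reflexivity).
    rewrite E. apply sat_consenv_ext with a.
    + intros i Hi. symmetry. apply upd_below. exact Hi.
    + apply (Hm m'). revert Hm'. apply sat_consenv_ext. intros i Hi. apply upd_below. exact Hi.
  - refine (@D_upto_ext A n a _ _ H k _ m' Hm'); [|lia].
    intros i Hi. symmetry. apply upd_below. exact Hi.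
Qed.

(** A new entry is a witness of the next formula if there is one, and arbitrary otherwise. *)
Lemma D_upto_extend (A : structure L) n n' (a : nat -> A) :
  n <= n' -> D_upto Phi A n a ->
  exists a', D_upto Phi A n' a' /\ forall i, i < n -> a' i = a i.
Proof.
  intros Hn. induction Hn as [|n' Hn IH]; intros H.
  - exists a. auto.
  - destruct (IH H) as (a' & Ha' & E).
    assert (Hm : exists m, forall m', sat A (consenv m' a') (Phi n') ->
      sat A (consenv m a') (Phi n')).
    { destruct (classic (exists m, sat A (consenv m a') (Phi n'))) as [[m Hm]|Hno].
      - exists m. auto.
      - exists (inhab A). intros m' Hm'. exfalso. eauto. }
    destruct Hm as [m Hm]. exists (upd a' n' m). split.
    + apply D_upto_upd; assumption.
    + intros i Hi. rewrite upd_below by lia. auto.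
Qed.

Lemma definable_D_at k0 : definable M (fun k (a : nat -> M k) =>
  forall m, sat (M k) (consenv m a) (Phi k0) -> sat (M k) (consenv (a k0) a) (Phi k0)).
Proof.
  apply definable_all1; [exact 0|]. apply definable_imp.
  - eapply definable_ext; [apply (definable_sat M (Phi k0)
      (fun v => match v with 0 => None | S i => Some i end))|].
    intros k z. simpl.
    match goal with |- sat _ ?a _ <-> sat _ ?b _ => replace a with b; [tauto|] end.
    apply functional_extensionality. intros [|v]; reflexivity.
  - eapply definable_ext; [apply (definable_sat M (Phi k0)
      (fun v => match v with 0 => Some k0 | S i => Some i end))|].
    intros k z. simpl.
    match goal with |- sat _ ?a _ <-> sat _ ?b _ => replace a with b; [tauto|] end.
    apply functional_extensionality. intros [|v]; reflexivity.
Qed.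

Lemma definable_D_upto n : definable M (fun k (a : nat -> M k) => D_upto Phi (M k) n a).
Proof. apply definable_lt; [exact 0|]. apply definable_D_at. Qed.

Lemma rich_definable (P : forall k, (nat -> M k) -> M k -> Prop) b :
  definable M (fun k (z : option nat -> M k) => P k (fun i => z (Some i)) (z None)) ->
  exists q, b <= q /\ forall k x y, P k x y <-> sat (M k) (consenv y x) (Phi q).
Proof.
  intros H.
  apply (definable_ren (fun o => match o with None => 0 | Some i => S i end)) in H.
  destruct (definable_nat H) as [phi Hphi]. destruct (fv_bound phi) as [n Hn].
  (* The sum [n + b] bounds the free variables and at the same time forces the position [q] beyond
     [b]. *)
  destruct (proj2 HPhi (n + b) phi) as (q & Hq & E).
  - intros v Hv. specialize (Hn v Hv). lia.
  - exists q. split; [lia|]. intros k x y. rewrite E. exact (Hphi k (consenv y x)).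
Qed.

(* Richness supplies coordinates [s j] of every [a] in [D_upto n'] that Skolemise
   the nonempty definable set [X a], and that take all values in it. *)
Lemma rich_skolem (J : Type) n (X : forall k, (nat -> M k) -> (J -> M k) -> Prop) :
  definable M (fun k (z : nat + J -> M k) => X k (fun i => z (inl i)) (fun j => z (inr j))) ->
  (forall k a a' w, (forall i, i < n -> a i = a' i) -> X k a w -> X k a' w) ->
  (forall k a, D_upto Phi (M k) n a -> exists w, X k a w) ->
  forall l : list J, exists n' (s : J -> nat), n < n' /\ (forall j, s j < n') /\
    (forall k a, D_upto Phi (M k) n' a ->
       exists w, X k a w /\ forall j, In j l -> w j = a (s j)) /\
    (forall k a w, D_upto Phi (M k) n a -> X k a w ->
       exists a', D_upto Phi (M k) n' a' /\ (forall i, i < n -> a' i = a i) /\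
         forall j, In j l -> a' (s j) = w j).
Proof.
  intros HX Xext Xne l. induction l as [|j0 l (n1 & s & Hn & Hs & Hw & Hsurj)].
  (* [S n] and not [n]: the stage has to grow strictly, and the default index [0] has to lie below
     it. *)
  - exists (S n), (fun _ => 0). split; [lia|]. split; [lia|]. split.
    + intros k a Ha. destruct (Xne k a) as [w Hw]; [apply D_upto_le with (S n); auto|].
      exists w. simpl. tauto.
    + intros k a w Ha Hw. destruct (D_upto_extend (le_S n n (le_n n)) Ha) as (a' & Ha' & E).
      exists a'. simpl. tauto.
  (* The formula admits a value for [j0] only if some point of [X x] has it together with the values
     already selected along [l], so the choices made one by one always extend to a point of
     [X x]. *)
  - destruct (@rich_definable (fun k x y => exists w, X k x w /\
      (forall j, In j l -> w j = x (s j)) /\ w j0 = y) n1) as (q & Hq & HPq).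
    { apply definable_ex; [exact None|]. apply definable_and; [|apply definable_and].
      - exact (definable_ren (fun c => match c with
          inl i => inl (Some i) | inr j => inr j end) HX).
      - apply definable_in; [exact (inl None)|]. intros j.
        apply (definable_eq M (inr j) (inl (Some (s j)))).
      - apply (definable_eq M (inr j0) (inl None)). }
    set (s' := fun j => if excluded_middle_informative (j = j0) then q else s j).
    assert (Hs'0 : s' j0 = q)
      by (unfold s'; destruct (excluded_middle_informative (j0 = j0)); congruence).
    assert (Hs' : forall j, j <> j0 -> s' j = s j)
      by (intros j Hj; unfold s'; destruct (excluded_middle_informative (j = j0)); congruence).
    assert (Hcase : forall j, In j (j0 :: l) -> j = j0 \/ (j <> j0 /\ In j l)).
    { intros j [->|Hj]; auto. destruct (classic (j = j0)); auto. }
    exists (S q), s'. split; [lia|]. split; [|split].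
    + intros j. destruct (classic (j = j0)) as [->|Hj].
      * rewrite Hs'0. lia.
      * rewrite Hs' by exact Hj. specialize (Hs j). lia.
    + intros k a Ha. destruct (Hw k a) as (w & HXw & Ew); [apply D_upto_le with (S q); auto; lia|].
      assert (Hq' : sat (M k) (consenv (w j0) a) (Phi q)) by (apply HPq; exists w; auto).
      apply (Ha q (Nat.lt_succ_diag_r q)) in Hq'. apply HPq in Hq'.
      destruct Hq' as (w' & HXw' & Ew' & Ej). exists w'. split; [exact HXw'|].
      intros j Hj. apply Hcase in Hj. destruct Hj as [->|[Hne Hj]].
      * rewrite Hs'0. exact Ej.
      * rewrite Hs' by exact Hne. auto.
    + intros k a w Ha HXw. destruct (Hsurj k a w Ha HXw) as (a1 & Ha1 & E1 & F1).
      destruct (D_upto_extend Hq Ha1) as (a2 & Ha2 & E2).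
      exists (upd a2 q (w j0)). split; [|split].
      * apply D_upto_upd; [exact Ha2|]. intros m' _. apply HPq. exists w.
        split; [|split; [|reflexivity]].
        -- apply Xext with a; [|exact HXw]. intros i Hi.
           rewrite E2 by lia. symmetry. auto.
        -- intros j Hj. rewrite E2 by apply Hs. symmetry. auto.
      * intros i Hi. rewrite upd_below, E2 by lia. auto.
      * intros j Hj. apply Hcase in Hj. destruct Hj as [->|[Hne Hj]].
        -- rewrite Hs'0. unfold upd. rewrite Nat.eqb_refl. reflexivity.
        -- rewrite Hs' by exact Hne. specialize (Hs j).
           rewrite upd_below, E2 by lia. auto.
Qed.

End Rich.

(** * Back and forth *)

(** The last clause, surjectivity, keeps the fibres of the next step nonempty. The bound on [u]
    concerns all [j] and [c], since whole infinite sequences are later compared entry by entry. *)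
Definition covers {L L' : language} {K : Type} {M : K -> structure L} {N : K -> structure L'}
  (G : interp L L') (pi : forall k, (nat -> M k) -> N k)
  (Phi : nat -> formula L) (Psi : nat -> formula L')
  (n m : nat) (u : nat -> nat -> nat) : Prop :=
  (forall j c, u j c < n) /\
  (forall k a, D_upto Phi (M k) n a ->
     (forall j, j < m -> sat (M k) (fun c => a (u j c)) (idom G)) /\
     D_upto Psi (N k) m (fun j => pi k (fun c => a (u j c)))) /\
  (forall k b, D_upto Psi (N k) m b ->
     exists a, D_upto Phi (M k) n a /\ forall j, j < m -> pi k (fun c => a (u j c)) = b j).

Definition retracts {L L' : language} {K : Type} {M : K -> structure L} {N : K -> structure L'}
  (pi : forall k, (nat -> M k) -> N k) (rho : forall k, (nat -> N k) -> M k)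
  (Phi : nat -> formula L) (n n' : nat) (v u : nat -> nat -> nat) : Prop :=
  forall k a, D_upto Phi (M k) n' a -> forall i, i < n ->
    rho k (fun c => pi k (fun c' => a (u (v i c) c'))) = a i.

(** [X a] is the fibre over [a] of the given map, with points of [N] replaced by representatives in
    [M]. Its part about [Psi] is definable by [pullback], its part about [rho] by
    [composite_definable], and it is nonempty because the given map is onto. The new [u] consists of
    the indices of its Skolem functions. *)
Lemma covers_step {L L' : language} {K : Type} {M : K -> structure L} {N : K -> structure L'}
  (G : interp L L') (Dl : interp L' L)
  (pi : forall k, (nat -> M k) -> N k) (rho : forall k, (nat -> N k) -> M k)
  (Phi : nat -> formula L) (Psi : nat -> formula L') :
  interp_wf G ->
  (forall k, interprets G (M k) (N k) (@pi k)) ->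
  composite_definable G Dl pi rho -> rich Phi -> rich Psi ->
  forall n m v, covers Dl rho Psi Phi m n v ->
  exists n' u, n < n' /\ covers G pi Phi Psi n' m u /\ retracts pi rho Phi n n' v u.
Proof.
  intros wfG HG Hchi HPhi HPsi n m v (Hv & Hdown & Hup).
  set (X := fun k (a : nat -> M k) (w : nat * nat -> M k) =>
    ((forall j, j < m -> sat (M k) (fun c => w (j, c)) (idom G)) /\
     D_upto Psi (N k) m (fun j => pi k (fun c => w (j, c)))) /\
    forall i, i < n -> rho k (fun c => pi k (fun c' => w (v i c, c'))) = a i).
  assert (DX : definable M (fun k (z : nat + nat * nat -> M k) =>
    X k (fun i => z (inl i)) (fun j => z (inr j)))).
  { destruct (pullback _ HG (fun j => j <? m) (definable_D_upto Psi m)) as (P & DP & HP).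
    { intros k y y' E. apply D_upto_ext; [exact HPsi|]. intros i Hi. apply E.
      apply Nat.ltb_lt. exact Hi. }
    apply (@definable_ext _ _ M _ (fun k (z : nat + nat * nat -> M k) =>
      ((forall j, j < m -> sat (M k) (fun c => z (inr (j, c))) (idom G)) /\
       P k (fun p => z (inr p))) /\
      forall i, i < n -> composite_graph G Dl (@pi k) (@rho k) (z (inl i))
        (fun p => z (inr (v i (fst p), snd p))))).
    - apply definable_and; [apply definable_and|].
      + apply definable_lt; [exact (inl 0)|]. intros j.
        apply (definable_sat M (idom G) (fun c => inr (j, c))).
      + exact (definable_ren inr DP).
      + apply definable_lt; [exact (inl 0)|]. intros i.
        apply (definable_ren (fun o => match o with
          None => inl i | Some p => inr (v i (fst p), snd p) end) Hchi).
    - intros k z.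
      assert (HPz : (forall j, j < m -> sat (M k) (fun c => z (inr (j, c))) (idom G)) ->
        (P k (fun p => z (inr p)) <->
         D_upto Psi (N k) m (fun j => pi k (fun c => z (inr (j, c)))))).
      { intros Hz. apply HP. intros j Hj. apply Hz. apply Nat.ltb_lt. exact Hj. }
      split.
      + intros [[H1 H2] H3]. split; [split; [exact H1|apply HPz; assumption]|].
        intros i Hi. destruct (Hdown k _ H2) as [Hd _]. split; [|split]; simpl.
        * intros j _. apply H1. apply Hv.
        * apply (Hd i Hi).
        * symmetry. apply H3. exact Hi.
      + intros [[H1 H2] H3]. split; [split; [exact H1|apply HPz; assumption]|].
        intros i Hi. destruct (H3 i Hi) as (_ & _ & E). symmetry. exact E. }
  assert (Xrep : forall k a (b : nat -> N k), D_upto Psi (N k) m b ->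
    (forall i, i < n -> rho k (fun c => b (v i c)) = a i) ->
    exists w, X k a w /\ forall j, pi k (fun c => w (j, c)) = b j).
  { intros k a b Hb Eb. destruct (HG k) as (Hsurj & _).
    destruct (choice_fun _ (fun j => Hsurj (b j))) as [w Hw].
    assert (E : (fun j => pi k (fun c => w j c)) = b)
      by (apply functional_extensionality; intros j; apply Hw).
    exists (fun p => w (fst p) (snd p)). split; [split; [split|]|]; simpl.
    - intros j _. apply Hw.
    - rewrite E. exact Hb.
    - intros i Hi. rewrite <- (Eb i Hi). f_equal.
      apply functional_extensionality. intros c. apply Hw.
    - intros j. apply Hw. }
  destruct (@rich_skolem _ _ M Phi HPhi _ n X DX) with
    (l := list_prod (seq 0 m) (seq 0 (idim G)))
    as (n' & s & Hn & Hs & Hw & Hsurj).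
  { intros k a a' w E [H1 H2]. split; [exact H1|]. intros i Hi. rewrite <- E by exact Hi. auto. }
  { intros k a Ha. destruct (Hup k a Ha) as (b & Hb & Eb).
    destruct (Xrep k a b Hb Eb) as (w & HXw & _). exists w. exact HXw. }
  exists n', (fun j c => s (j, c)). split; [exact Hn|].
  assert (Hin : forall j c, j < m -> c < idim G ->
    In (j, c) (list_prod (seq 0 m) (seq 0 (idim G)))).
  { intros j c Hj Hc. apply in_prod; apply in_seq; lia. }
  assert (HX : forall k a, D_upto Phi (M k) n' a -> X k a (fun p => a (s p))).
  { intros k a Ha. destruct (Hw k a Ha) as (w & ((H1 & H2) & H3) & Ew).
    assert (E : forall j, j < m -> pi k (fun c => w (j, c)) = pi k (fun c => a (s (j, c)))).
    { intros j Hj. apply (interprets_ext _ _ wfG (HG k)); auto. }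
    split; [split|].
    - intros j Hj. apply idom_ext with (fun c => w (j, c)); auto.
    - apply D_upto_ext with (fun j => pi k (fun c => w (j, c))); auto.
    - intros i Hi. rewrite <- (H3 i Hi). f_equal.
      apply functional_extensionality. intros c. symmetry. apply E. apply Hv. }
  split; [split; [|split]|].
  - intros j c. apply Hs.
  - intros k a Ha. apply (HX k a Ha).
  (* To reach [b], start from its image under [rho] in stage [n]: representatives of [b] lie in the
     fibre over this image, and by [rich_skolem] some extension of the image carries them as its
     Skolem values. *)
  - intros k b Hb. destruct (Hdown k b Hb) as [_ Ha].
    destruct (Xrep k (fun i => rho k (fun c => b (v i c))) b Hb) as (w & HXw & Ew);
      [reflexivity|].
    destruct (Hsurj k _ w Ha HXw) as (a' & Ha' & _ & Es). exists a'. split; [exact Ha'|].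
    intros j Hj. rewrite <- (Ew j). symmetry.
    apply (interprets_ext _ _ wfG (HG k)); [|apply HXw; exact Hj].
    intros c Hc. symmetry. apply Es. auto.
  - intros k a Ha i Hi. apply (HX k a Ha). exact Hi.
Qed.

(** The indices [u s j] may change with the stage, but the elements of [N] that they select from a
    realisation of [D_Phi] do not. Hence [U j] may be taken from any stage that contains [j], and
    likewise [V i]. *)
Lemma zigzag_limit {L L' : language} {K : Type} {M : K -> structure L} {N : K -> structure L'}
  (G : interp L L') (Dl : interp L' L)
  (pi : forall k, (nat -> M k) -> N k) (rho : forall k, (nat -> N k) -> M k)
  (Phi : nat -> formula L) (Psi : nat -> formula L')
  (n m : nat -> nat) (u v : nat -> nat -> nat -> nat) (U V : nat -> nat -> nat) :
  rich Psi -> (forall s, s < m s) -> (forall s, m s <= m (S s)) ->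
  (forall s, covers G pi Phi Psi (n (S s)) (m s) (u s)) ->
  (forall s, covers Dl rho Psi Phi (m s) (n s) (v s)) ->
  (forall s, retracts pi rho Phi (n s) (n (S s)) (v s) (u s)) ->
  (forall s, retracts rho pi Psi (m s) (m (S s)) (u s) (v (S s))) ->
  (forall j, exists s, j < m s /\ U j = u s j) ->
  (forall i, exists s, i < n s /\ V i = v s i) ->
  forall k a, realises_D Phi (M k) a ->
    (forall j, sat (M k) (fun c => a (U j c)) (idom G)) /\
    realises_D Psi (N k) (fun j => pi k (fun c => a (U j c))) /\
    forall i, rho k (fun c => pi k (fun c' => a (U (V i c) c'))) = a i.
Proof.
  intros HPsi Hm Hm' Hu Hv Ru Rv HU HV k a Ha.
  rewrite realises_D_upto in Ha.
  set (b := fun s j => pi k (fun c => a (u s j c))).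
  assert (Hb : forall s, D_upto Psi (N k) (m s) (b s)).
  { intros s. destruct (Hu s) as (_ & H & _). apply (H k a). apply Ha. }
  (* [b (S s) j] equals [pi] of certain values of [rho] on [b (S s)], and those values are the
     entries of [a] with indices [u s j c]. *)
  assert (Hstep : forall s j, j < m s -> b (S s) j = b s j).
  { intros s j Hj. rewrite <- (Rv s k (b (S s)) (Hb (S s)) j Hj). unfold b at 2.
    f_equal. apply functional_extensionality. intros c.
    apply (Ru (S s) k a); [apply Ha|]. apply (Hu s). }
  assert (Hmono : forall s t, s <= t -> m s <= m t /\ forall j, j < m s -> b t j = b s j).
  { intros s t Hst. induction Hst as [|t Hst [IH1 IH2]]; [auto|].
    split; [specialize (Hm' t); lia|]. intros j Hj. rewrite Hstep by lia. auto. }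
  assert (HbU : forall s j, j < m s -> pi k (fun c => a (U j c)) = b s j).
  { intros s j Hj. destruct (HU j) as (s0 & Hj0 & ->). fold (b s0 j).
    destruct (Nat.le_ge_cases s s0) as [Hs|Hs].
    - apply (Hmono s s0 Hs). exact Hj.
    - symmetry. apply (Hmono s0 s Hs). exact Hj0. }
  split; [|split].
  - intros j. destruct (HU j) as (s & Hj & ->). destruct (Hu s) as (_ & H & _).
    apply (H k a); auto.
  - apply realises_D_upto. intros s. apply D_upto_ext with (b s); [exact HPsi| |].
    + intros j Hj. symmetry. apply HbU. specialize (Hm s). lia.
    + apply D_upto_le with (m s); auto. specialize (Hm s). lia.
  - intros i. destruct (HV i) as (s & Hi & ->).
    rewrite <- (Ru s k a (Ha _) i Hi). f_equal.
    apply functional_extensionality. intros c. apply HbU. apply (Hv s).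
Qed.

Section Zigzag.
Context {L L' : language} {K : Type} {M : K -> structure L} {N : K -> structure L'}.
Variables (G : interp L L') (Dl : interp L' L).
Variable pi : forall k, (nat -> M k) -> N k.
Variable rho : forall k, (nat -> N k) -> M k.
Variables (Phi : nat -> formula L) (Psi : nat -> formula L').
Hypothesis wfG : interp_wf G.
Hypothesis wfDl : interp_wf Dl.
Hypothesis HG : forall k, interprets G (M k) (N k) (@pi k).
Hypothesis HDl : forall k, interprets Dl (N k) (M k) (@rho k).
Hypothesis Hchi : composite_definable G Dl pi rho.
Hypothesis Heta : composite_definable Dl G rho pi.
Hypothesis HPhi : rich Phi.
Hypothesis HPsi : rich Psi.

Definition stage : Type := nat * nat * (nat -> nat -> nat).

Definition stage_ok (x : stage) : Prop :=
  covers Dl rho Psi Phi (snd (fst x)) (fst (fst x)) (snd x).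

Definition stage_next (x : stage) (y : stage * (nat -> nat -> nat)) : Prop :=
  let '(n, m, v) := x in let '((n', m', v'), u) := y in
  n < n' /\ m < m' /\ stage_ok (n', m', v') /\
  covers G pi Phi Psi n' m u /\ retracts pi rho Phi n n' v u /\
  retracts rho pi Psi m m' u v'.

(** The hypothesis stands under the existential quantifier so that choice yields a successor
    function on all triples, valid or not. *)
Lemma stage_next_exists (x : stage) : exists y, stage_ok x -> stage_next x y.
Proof.
  destruct x as [[n m] v].
  destruct (classic (stage_ok (n, m, v))) as [Hx|]; [|exists (n, m, v, v); tauto].
  destruct (covers_step wfG HG Hchi HPhi HPsi Hx) as (n' & u & Hn & Hu & Ru).
  destruct (covers_step wfDl HDl Heta HPsi HPhi Hu) as (m' & v' & Hm & Hv & Rv).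
  exists (n', m', v', u). intros _.
  exact (conj Hn (conj Hm (conj Hv (conj Hu (conj Ru Rv))))).
Qed.

(** Stage [0] of [Phi] imposes no condition. On the side of [Psi] the start is [1], so that the
    constant index [0] is admissible and [s < m s] holds from the beginning. *)
Lemma stage_initial : stage_ok (0, 1, fun _ _ => 0).
Proof.
  split; [|split]; simpl.
  - intros _ _. lia.
  - intros k b _. split; intros j Hj; lia.
  - intros k a _.
    destruct (@D_upto_extend _ Psi HPsi (N k) 0 1 (fun _ => inhab (N k))) as (b & Hb & _).
    + lia.
    + intros j Hj. lia.
    + exists b. split; [exact Hb|]. intros j Hj. lia.
Qed.

Lemma zigzag : exists U V : nat -> nat -> nat,
  (forall k a, realises_D Phi (M k) a ->
    (forall j, sat (M k) (fun c => a (U j c)) (idom G)) /\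
    realises_D Psi (N k) (fun j => pi k (fun c => a (U j c))) /\
    forall i, rho k (fun c => pi k (fun c' => a (U (V i c) c'))) = a i) /\
  (forall k b, realises_D Psi (N k) b ->
    (forall i, sat (N k) (fun c => b (V i c)) (idom Dl)) /\
    realises_D Phi (M k) (fun i => rho k (fun c => b (V i c))) /\
    forall j, pi k (fun c => rho k (fun c' => b (V (U j c) c'))) = b j).
Proof.
  destruct (choice_fun _ stage_next_exists) as [next Hnext].
  set (st := fix st s := match s with
    | 0 => (0, 1, fun _ _ => 0) | S s => fst (next (st s)) end).
  assert (Hok : forall s, stage_ok (st s) /\ stage_next (st s) (next (st s))).
  { intros s. assert (Hs : stage_ok (st s)); [|auto].
    induction s as [|s IH]; [apply stage_initial|]. simpl.
    specialize (Hnext _ IH). destruct (st s) as [[n m] v].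
    destruct (next (n, m, v)) as [[[n' m'] v'] u]. apply Hnext. }
  set (n := fun s => fst (fst (st s))). set (m := fun s => snd (fst (st s))).
  set (v := fun s => snd (st s)). set (u := fun s => snd (next (st s))).
  assert (H : forall s, n s < n (S s) /\ m s < m (S s) /\
    covers Dl rho Psi Phi (m s) (n s) (v s) /\
    covers G pi Phi Psi (n (S s)) (m s) (u s) /\
    retracts pi rho Phi (n s) (n (S s)) (v s) (u s) /\
    retracts rho pi Psi (m s) (m (S s)) (u s) (v (S s))).
  { intros s. destruct (Hok s) as [H1 H2]. unfold n, m, v, u. simpl.
    destruct (st s) as [[n0 m0] v0]. destruct (next (n0, m0, v0)) as [[[n' m'] v'] u'].
    destruct H2 as (A1 & A2 & _ & A4 & A5 & A6).
    exact (conj A1 (conj A2 (conj H1 (conj A4 (conj A5 A6))))). }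
  assert (Hm : forall s, s < m s).
  { induction s as [|s IH]; [unfold m; simpl; lia|]. specialize (H s). lia. }
  assert (Hn : forall s, s < n (S s)).
  { induction s as [|s IH]; [specialize (H 0); lia|]. specialize (H (S s)). lia. }
  (* Diagonal choices, legitimate because [j < m j] and [i < n (S i)]. *)
  exists (fun j => u j j), (fun i => v (S i) i). split.
  - apply (@zigzag_limit _ _ _ _ _ G Dl pi rho Phi Psi n m u v
      (fun j => u j j) (fun i => v (S i) i)); try (intros s; apply H); auto.
    + intros s. specialize (H s). lia.
    + intros j. exists j. auto.
    + intros i. exists (S i). auto.
  (* The same zigzag entered half a step later, whence the shifts of [n] and [v]. *)
  - apply (@zigzag_limit _ _ _ _ _ Dl G rho pi Psi Phi m (fun s => n (S s))
      (fun s => v (S s)) u (fun i => v (S i) i) (fun j => u j j)); try (intros s; apply H); auto.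
    + intros s. specialize (H (S s)). lia.
    + intros i. exists i. auto.
    + intros j. exists j. auto.
Qed.

End Zigzag.

(** * The induced map of groupoids *)

Section GroupoidMap.
Context {L L' : language} {K : Type} {M : K -> structure L} {N : K -> structure L'}.
Variables (T : theory L) (T' : theory L') (G : interp L L') (Dl : interp L' L).
Variable pi : forall k, (nat -> M k) -> N k.
Variable rho : forall k, (nat -> N k) -> M k.
Variables (Phi : nat -> formula L) (Psi : nat -> formula L').
Variables U V : nat -> nat -> nat.
Hypothesis HN : forall k, models T' (N k).
Hypothesis Hcov : forall A, models T A -> exists k, M k = A.
Hypothesis HG : forall k, interprets G (M k) (N k) (@pi k).
Hypothesis Heta : composite_definable Dl G rho pi.
Hypothesis HPsi : rich Psi.

Definition read k (a : nat -> M k) (j : nat) : N k := pi k (fun c => a (U j c)).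

Hypothesis HUV : forall k a, realises_D Phi (M k) a ->
  (forall j, sat (M k) (fun c => a (U j c)) (idom G)) /\
  realises_D Psi (N k) (@read k a) /\
  forall i, rho k (fun c => @read k a (V i c)) = a i.
Hypothesis HVdom : forall k b, realises_D Psi (N k) b ->
  forall i, sat (N k) (fun c => b (V i c)) (idom Dl).

(** That one [phi] works for all [k] makes the map on types well defined across different models;
    the same [phi] gives continuity. *)
Lemma read_tp (psi : formula L') : exists phi, forall k a b,
  realises_D Phi (M k) a -> realises_D Phi (M k) b ->
  (tp (M k) a b phi <-> tp (N k) (@read k a) (@read k b) psi).
Proof.
  destruct (pullback _ HG (fun _ => true) (definable_sat N psi (fun v : nat => v)))
    as (P & DP & HP).
  { intros k y y' E. replace y' with y; [auto|].
    apply functional_extensionality. auto. }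
  (* Variable [w] of [psi] is entry [w / 2] of one of the two tuples read; its coordinates are the
     entries [U (w / 2) c] of [a] or [b], found at even or odd positions of the pairing. *)
  destruct (definable_nat (definable_ren (fun p : nat * nat =>
    if Nat.even (fst p) then 2 * U (Nat.div2 (fst p)) (snd p)
    else 2 * U (Nat.div2 (fst p)) (snd p) + 1) DP)) as [phi Hphi].
  exists phi. intros k a b Ha Hb. unfold tp. rewrite <- Hphi.
  assert (E : (fun p : nat * nat => pairenv a b
      (if Nat.even (fst p) then 2 * U (Nat.div2 (fst p)) (snd p)
       else 2 * U (Nat.div2 (fst p)) (snd p) + 1)) =
    fun p => (if Nat.even (fst p) then a else b) (U (Nat.div2 (fst p)) (snd p))).
  { apply functional_extensionality. intros p.
    destruct (Nat.even (fst p)); [apply pairenv_even|apply pairenv_odd]. }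
  rewrite E, HP; simpl.
  - match goal with |- sat _ ?x _ <-> sat _ ?y _ => replace x with y; [tauto|] end.
    apply functional_extensionality. intros w. unfold pairenv, read.
    destruct (Nat.even w); reflexivity.
  - intros w _. destruct (Nat.even w); apply HUV; assumption.
Qed.

Lemma read_tp_eq k k' a b a' b' :
  realises_D Phi (M k) a -> realises_D Phi (M k) b ->
  realises_D Phi (M k') a' -> realises_D Phi (M k') b' ->
  tp (M k) a b = tp (M k') a' b' ->
  tp (N k) (@read k a) (@read k b) = tp (N k') (@read k' a') (@read k' b').
Proof.
  intros Ha Hb Ha' Hb' E. apply functional_extensionality. intros psi.
  apply propositional_extensionality. destruct (read_tp psi) as [phi H].
  rewrite <- (H k a b), <- (H k' a' b') by assumption. rewrite E. tauto.
Qed.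

(** The graphs of composition and inversion present an element by tuples not assumed to realise
    [D_Phi]. As [D_Phi] is a set of formulas, the type itself ensures it. *)
Lemma tp_realises_D k k' a b a' b' :
  tp (M k) a b = tp (M k') a' b' ->
  realises_D Phi (M k') a' -> realises_D Phi (M k') b' ->
  realises_D Phi (M k) a /\ realises_D Phi (M k) b.
Proof.
  intros E Ha' Hb'. split; intros k0.
  - destruct (definable_nat (definable_ren (fun i => 2 * i)
      (definable_D_at (M := M) Phi k0))) as [phi H].
    assert (EE : forall k (a b : nat -> M k), (fun i => pairenv a b (2 * i)) = a)
      by (intros; apply functional_extensionality; intros i; apply pairenv_even).
    generalize (H k (pairenv a b)), (H k' (pairenv a' b')).
    fold (tp (M k) a b phi) (tp (M k') a' b' phi). rewrite !EE, !pairenv_even, E.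
    intros H1 H2. exact (proj2 H1 (proj1 H2 (Ha' k0))).
  - destruct (definable_nat (definable_ren (fun i => 2 * i + 1)
      (definable_D_at (M := M) Phi k0))) as [phi H].
    assert (EE : forall k (a b : nat -> M k), (fun i => pairenv a b (2 * i + 1)) = b)
      by (intros; apply functional_extensionality; intros i; apply pairenv_odd).
    generalize (H k (pairenv a b)), (H k' (pairenv a' b')).
    fold (tp (M k) a b phi) (tp (M k') a' b' phi). rewrite !EE, !pairenv_odd, E.
    intros H1 H2. exact (proj2 H1 (proj1 H2 (Hb' k0))).
Qed.

(* An entry of [read a] is [pi (rho (..))] of entries of [read a'], hence, being
   definable over them, an entry of [read a'] by richness. *)
Lemma read_entries k a a' :
  realises_D Phi (M k) a -> realises_D Phi (M k) a' ->
  (forall i, exists j, a i = a' j) ->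
  forall j, exists j', @read k a j = @read k a' j'.
Proof.
  intros Ha Ha' Hin j. destruct (choice_fun _ Hin) as [t Ht].
  destruct (HUV Ha) as (Hd & _ & _). destruct (HUV Ha') as (_ & Hb' & Er).
  set (P := fun k (x : nat -> N k) (y : N k) =>
    composite_graph Dl G (@rho k) (@pi k) y (fun p => x (V (t (U j (fst p))) (snd p)))).
  destruct (rich_definable HPsi P 0) as (q & _ & Hq).
  { exact (definable_ren (fun o => match o with
      None => None | Some p => Some (V (t (U j (fst p))) (snd p)) end) Heta). }
  assert (Ea : (fun c => rho k (fun c' => @read k a' (V (t (U j c)) c')))
    = fun c => a (U j c)).
  { apply functional_extensionality. intros c. rewrite Er. symmetry. apply Ht. }
  assert (Hy : P k (@read k a') (@read k a j)).
  { split; [|split]; simpl.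
    - intros c _. apply HVdom. exact Hb'.
    - rewrite Ea. apply Hd.
    - rewrite Ea. reflexivity. }
  apply Hq, Hb', Hq in Hy. destruct Hy as (_ & _ & Hy). simpl in Hy.
  exists q. rewrite Hy, Ea. reflexivity.
Qed.

(** Ranging over all presentations of [p] avoids choosing one; by [read_tp_eq] they all give the
    same result. *)
Definition read_type (p : formula L -> Prop) (psi : formula L') : Prop :=
  exists k a b, realises_D Phi (M k) a /\ realises_D Phi (M k) b /\
    p = tp (M k) a b /\ tp (N k) (@read k a) (@read k b) psi.

Lemma read_typeE k a b : realises_D Phi (M k) a -> realises_D Phi (M k) b ->
  read_type (tp (M k) a b) = tp (N k) (@read k a) (@read k b).
Proof.
  intros Ha Hb. apply functional_extensionality. intros psi.
  apply propositional_extensionality. split.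
  - intros (k' & a' & b' & Ha' & Hb' & E & H).
    rewrite (@read_tp_eq k k' a b a' b') by assumption. exact H.
  - intros H. exists k, a, b. auto.
Qed.

Lemma read_type_pred p : GPhi_pred T Phi p -> GPhi_pred T' Psi (read_type p).
Proof.
  intros (A & HA & a & b & Ha & Hb & [Hab Hba] & ->).
  destruct (Hcov HA) as [k <-]. rewrite read_typeE by assumption.
  exists (N k). split; [apply HN|]. exists (@read k a), (@read k b).
  repeat split; try (apply HUV; assumption).
  - apply read_entries; assumption.
  - apply read_entries; assumption.
Qed.

Definition groupoid_map (g : GPhi_carrier T Phi) : GPhi_carrier T' Psi :=
  exist _ (read_type (proj1_sig g)) (read_type_pred (proj2_sig g)).

Lemma GPhi_realises (g : GPhi_carrier T Phi) k a b :
  proj1_sig g = tp (M k) a b -> realises_D Phi (M k) a /\ realises_D Phi (M k) b.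
Proof.
  intros Eg. destruct (proj2_sig g) as (A & HA & a' & b' & Ha' & Hb' & _ & E).
  destruct (Hcov HA) as [k' <-]. rewrite Eg in E. exact (tp_realises_D E Ha' Hb').
Qed.

Lemma groupoid_mapE (g : GPhi_carrier T Phi) k a b :
  proj1_sig g = tp (M k) a b ->
  proj1_sig (groupoid_map g) = tp (N k) (@read k a) (@read k b).
Proof.
  intros E. destruct (GPhi_realises g E) as [Ha Hb]. simpl. rewrite E.
  apply read_typeE; assumption.
Qed.

Lemma GPhi_presentation (g : GPhi_carrier T Phi) :
  exists k a b, proj1_sig g = tp (M k) a b.
Proof.
  destruct (proj2_sig g) as (A & HA & a & b & _ & _ & _ & E).
  destruct (Hcov HA) as [k <-]. eauto.
Qed.

Lemma groupoid_map_comp g h l :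
  GPhi_comp g h l -> GPhi_comp (groupoid_map g) (groupoid_map h) (groupoid_map l).
Proof.
  intros (A & HA & a & b & c & Eg & Eh & El). destruct (Hcov HA) as [k <-].
  exists (N k). split; [apply HN|]. exists (@read k a), (@read k b), (@read k c).
  split; [|split]; apply groupoid_mapE; assumption.
Qed.

Lemma groupoid_map_inv g l :
  GPhi_inv g l -> GPhi_inv (groupoid_map g) (groupoid_map l).
Proof.
  intros (A & HA & a & b & Eg & El). destruct (Hcov HA) as [k <-].
  exists (N k). split; [apply HN|]. exists (@read k a), (@read k b).
  split; apply groupoid_mapE; assumption.
Qed.

Lemma groupoid_map_continuous W :
  GPhi_open W -> GPhi_open (fun g => W (groupoid_map g)).
Proof.
  intros HW g Hg. destruct (HW _ Hg) as (psi & Hpsi & Hall).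
  destruct (read_tp psi) as [phi Hphi].
  assert (H : forall h : GPhi_carrier T Phi,
    proj1_sig h phi <-> proj1_sig (groupoid_map h) psi).
  { intros h. destruct (GPhi_presentation h) as (k & a & b & E).
    destruct (GPhi_realises h E) as [Ha Hb].
    rewrite (groupoid_mapE h E), E. apply Hphi; assumption. }
  exists phi. split; [apply H; exact Hpsi|]. intros h Hh. apply Hall, H, Hh.
Qed.

End GroupoidMap.

(** * Bi-interpretations *)

(** Lets the interpreted structure be replaced by an isomorphic one, so that a composite
    interpretation can land in the very structure from which it started. *)
Lemma interprets_iso (L L' : language) (G : interp L L') (M : structure L)
  (N N' : structure L') (pi : (nat -> M) -> N') (h : N -> N') :
  interprets G M N' pi -> struct_iso N N' h ->
  exists h' : N' -> N, (forall x y, h x = y <-> x = h' y) /\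
    interprets G M N (fun x => h' (pi x)).
Proof.
  intros (Hs & He & Hr & Hf) ((h' & H1 & H2) & Hhf & Hhr).
  exists h'. split; [intros x y; split; [intros <-|intros ->]; auto|].
  split; [|split; [|split]].
  - intros y. destruct (Hs (h y)) as (x & Hx & E). exists x. rewrite E. auto.
  - intros x x' Hx Hx'. rewrite <- He by assumption. split; [|congruence].
    intros E. rewrite <- (H2 (pi x)), <- (H2 (pi x')), E. reflexivity.
  - intros r xs Hxs. rewrite Hhr, <- Hr by exact Hxs.
    replace (fun i => h (h' (pi (xs (@finidx (rarity L' r) i)))))
      with (fun i => pi (xs (@finidx (rarity L' r) i))); [tauto|].
    apply functional_extensionality. intros i. auto.
  - intros f xs Hxs. rewrite <- Hf by exact Hxs.
    assert (E : h (funs N f (fun i => h' (pi (xs (finidx i)))))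
      = funs N' f (fun i => pi (xs (finidx i)))).
    { rewrite Hhf. f_equal. apply functional_extensionality. auto. }
    rewrite <- E. split; intros Ef; [rewrite Ef; auto|rewrite <- Ef; auto].
Qed.

(** The index type [K] of the families: a model of each theory, interpreting each other, normalised
    so that [chi] is exactly the graph of [rho o pi]. *)
Record coupling {L L' : language} (T : theory L) (T' : theory L')
  (G : interp L L') (Dl : interp L' L) (chi : formula L) := {
  cpl_below : structure L;
  cpl_above : structure L';
  cpl_pi : (nat -> cpl_below) -> cpl_above;
  cpl_rho : (nat -> cpl_above) -> cpl_below;
  cpl_below_models : models T cpl_below;
  cpl_above_models : models T' cpl_above;
  cpl_interprets : interprets G cpl_below cpl_above cpl_pi;
  cpl_interprets' : interprets Dl cpl_above cpl_below cpl_rho;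
  cpl_chi : forall m (zs : nat -> nat -> cpl_below),
    sat cpl_below (consenv m (blockenv (idim G) zs)) chi <->
    composite_graph G Dl cpl_pi cpl_rho m (fun p => zs (fst p) (snd p))
}.

Section BiInterpretation.
Context {L L' : language}.
Variables (T : theory L) (T' : theory L') (G : interp L L') (Dl : interp L' L).
Variables (chi : formula L) (chi' : formula L').
Hypothesis HG : interpretation_of T T' G.
Hypothesis HDl : interpretation_of T' T Dl.
Hypothesis Hchi : definable_composite T G Dl chi.
Hypothesis Hchi' : definable_composite T' Dl G chi'.

(* Composing [rho] with the inverse of the given identification makes [chi] the graph
   of [rho o pi] itself. *)
Lemma coupling_untwist (M M' : structure L) (N : structure L')
  (pi : (nat -> M) -> N) (rho : (nat -> N) -> M') :
  models T M -> models T' N -> interprets G M N pi -> interprets Dl N M' rho ->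
  exists k : coupling T T' G Dl chi, cpl_below k = M /\ cpl_above k = N.
Proof.
  intros HM HN Hpi Hrho. destruct Hchi as [_ Hc].
  destruct (Hc M HM N pi Hpi M' rho Hrho) as (h & Hh & Hgraph).
  destruct (interprets_iso Hrho Hh) as (h' & Hh' & Hrho').
  unshelve eexists (@Build_coupling _ _ T T' G Dl chi M N pi _ HM HN Hpi Hrho' _); [|auto].
  intros m zs. rewrite Hgraph, Hh'. reflexivity.
Qed.

Lemma coupling_over (M : structure L) : models T M ->
  exists k : coupling T T' G Dl chi, cpl_below k = M.
Proof.
  intros HM. destruct (proj2 HG M HM) as (N & pi & HN & Hpi).
  destruct (proj2 HDl N HN) as (M' & rho & _ & Hrho).
  destruct (coupling_untwist HM HN Hpi Hrho) as (k & Hk & _). eauto.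
Qed.

(** The isomorphism belonging to [chi'] carries [pi] back to the given [N]; only then is [rho]
    adjusted to [chi], which leaves [N] in place. *)
Lemma coupling_under (N : structure L') : models T' N ->
  exists k : coupling T T' G Dl chi, cpl_above k = N.
Proof.
  intros HN. destruct (proj2 HDl N HN) as (M & rho & HM & Hrho).
  destruct (proj2 HG M HM) as (N' & pi & _ & Hpi).
  destruct (proj2 Hchi' N HN M rho Hrho N' pi Hpi) as (h & Hh & _).
  destruct (interprets_iso Hpi Hh) as (h' & _ & Hpi').
  destruct (coupling_untwist HM HN Hpi' Hrho) as (k & _ & Hk). eauto.
Qed.

Let K := coupling T T' G Dl chi.

Lemma coupling_composite :
  @composite_definable _ _ K (fun k => cpl_below k) (fun k => cpl_above k) G Dl
    (fun k => cpl_pi k) (fun k => cpl_rho k).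
Proof.
  exists chi, (fun v => match v with
    0 => None | S w => Some (w / idim G, w mod idim G) end).
  intros k x. simpl.
  transitivity (composite_graph G Dl (cpl_pi k) (cpl_rho k) (x None)
    (fun p => x (Some (fst p, snd p)))).
  - split; intros H; exact H.
  - rewrite <- (cpl_chi k (x None) (fun j c => x (Some (j, c)))).
    match goal with |- sat _ ?a _ <-> sat _ ?b _ => replace a with b; [tauto|] end.
    apply functional_extensionality. intros [|v]; reflexivity.
Qed.

(** The isomorphism belonging to [chi'] is now a bijection of [N] with itself, chosen for each [k]
    separately; it enters [composite_definable_converse] as the twist [h]. *)
Lemma coupling_composite_converse :
  @composite_definable _ _ K (fun k => cpl_above k) (fun k => cpl_below k) Dl G
    (fun k => cpl_rho k) (fun k => cpl_pi k).
Proof.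
  assert (Hex : forall k : K, exists h : cpl_above k -> cpl_above k,
    (exists h', (forall x, h' (h x) = x) /\ (forall y, h (h' y) = y)) /\
    forall n (zs : nat -> nat -> cpl_above k),
      sat (cpl_above k) (consenv n (blockenv (idim Dl) zs)) chi' <->
      composite_graph Dl G (cpl_rho k) (cpl_pi k) (h n) (fun p => zs (fst p) (snd p))).
  { intros k. destruct (proj2 Hchi' _ (cpl_above_models k) _ _ (cpl_interprets' k)
      _ _ (cpl_interprets k)) as (h & [Hh _] & Hgraph).
    exists h. split; [exact Hh|exact Hgraph]. }
  set (h := fun k => proj1_sig (constructive_indefinite_description _ (Hex k))).
  assert (Hh : forall k : K,
    (exists h', (forall x, h' (h k x) = x) /\ (forall y, h k (h' y) = y)) /\
    forall n (zs : nat -> nat -> cpl_above k),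
      sat (cpl_above k) (consenv n (blockenv (idim Dl) zs)) chi' <->
      composite_graph Dl G (cpl_rho k) (cpl_pi k) (h k n) (fun p => zs (fst p) (snd p)))
    by (intros k; exact (proj2_sig (constructive_indefinite_description _ (Hex k)))).
  apply (composite_definable_converse (proj1 HG) (proj1 HDl)
    (fun k : K => cpl_interprets k) (fun k => cpl_interprets' k) coupling_composite h).
  - intros k x y E. destruct (Hh k) as [(h' & H1 & _) _].
    rewrite <- (H1 x), <- (H1 y), E. reflexivity.
  - intros k y. destruct (Hh k) as [(h' & _ & H2) _]. exists (h' y). apply H2.
  - exists chi', (fun v => match v with
      0 => None | S w => Some (w / idim Dl, w mod idim Dl) end).
    intros k x.
    transitivity (composite_graph Dl G (cpl_rho k) (cpl_pi k) (h k (x None))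
      (fun p => x (Some (fst p, snd p)))).
    + split; intros H; exact H.
    + rewrite <- (proj2 (Hh k) (x None) (fun j c => x (Some (j, c)))).
      match goal with |- sat _ ?a _ <-> sat _ ?b _ => replace a with b; [tauto|] end.
      apply functional_extensionality. intros [|v]; reflexivity.
Qed.

End BiInterpretation.

Lemma GPhi_carrier_eq (L : language) (T : theory L) (Phi : nat -> formula L)
  (g h : GPhi_carrier T Phi) : proj1_sig g = proj1_sig h -> g = h.
Proof.
  destruct g as [p Hp], h as [q Hq]. simpl. intros ->.
  f_equal. apply proof_irrelevance.
Qed.

Theorem theorem2p12 (L L' : language) (T : theory L) (T' : theory L')
  (Phi : nat -> formula L) (Psi : nat -> formula L') :
  complete_theory T -> no_singleton_models T ->
  complete_theory T' -> no_singleton_models T' ->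
  bi_interpretable T T' ->
  rich Phi -> rich Psi ->
  tgroupoid_iso (G_Phi T Phi) (G_Phi T' Psi).
Proof.
  intros _ _ _ _ (G & Dl & chi & chi' & HG & HDl & Hchi & Hchi') HPhi HPsi.
  set (K := coupling T T' G Dl chi).
  pose proof (coupling_composite T T' G Dl chi) as Cchi.
  pose proof (coupling_composite_converse chi HG HDl Hchi') as Ceta.
  pose proof (fun k : K => cpl_interprets k) as IG.
  pose proof (fun k : K => cpl_interprets' k) as ID.
  pose proof (coupling_over HG HDl Hchi) as covM.
  pose proof (coupling_under HG HDl Hchi Hchi') as covN.
  destruct (zigzag (proj1 HG) (proj1 HDl) IG ID Cchi Ceta HPhi HPsi)
    as (U & V & HUV & HVU).
  set (F := groupoid_map V (fun k : K => cpl_above_models k) covM IG Ceta HPsi HUV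
    (fun k b Hb => proj1 (HVU k b Hb))).
  set (H := groupoid_map U (fun k : K => cpl_below_models k) covN ID Cchi HPhi HVU
    (fun k a Ha => proj1 (HUV k a Ha))).
  assert (HF : forall g, H (F g) = g).
  { intros g. apply GPhi_carrier_eq.
    destruct (GPhi_presentation covM g) as (k & a & b & E).
    destruct (GPhi_realises covM g k E) as [Ha Hb].
    unfold H. erewrite groupoid_mapE by (unfold F; apply groupoid_mapE; exact E).
    rewrite E. f_equal; apply functional_extensionality; intros i.
    - apply (HUV k a Ha).
    - apply (HUV k b Hb). }
  assert (FH : forall g, F (H g) = g).
  { intros g. apply GPhi_carrier_eq.
    destruct (GPhi_presentation covN g) as (k & a & b & E).
    destruct (GPhi_realises covN g k E) as [Ha Hb].
    unfold F. erewrite groupoid_mapE by (unfold H; apply groupoid_mapE; exact E).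
    rewrite E. f_equal; apply functional_extensionality; intros i.
    - apply (HVU k a Ha).
    - apply (HVU k b Hb). }
  exists F, H. split; [exact HF|]. split; [exact FH|]. split; [|split; [|split]].
  - intros g h l. split; [apply groupoid_map_comp|].
    intros Hc. rewrite <- (HF g), <- (HF h), <- (HF l).
    revert Hc. apply groupoid_map_comp.
  - intros g l. split; [apply groupoid_map_inv|].
    intros Hc. rewrite <- (HF g), <- (HF l). revert Hc. apply groupoid_map_inv.
  - intros W. apply groupoid_map_continuous.
  - intros W. apply groupoid_map_continuous.
Qed.
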